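(* Isomorphism of 3-multipedes with shoes is computable in PTime: there is a polynomial time algorithm which, given a pair of 3-multipedes with shoes (as a single structure, encoded using any linear ordering of its universe), decides whether they are isomorphic.
   Context: A 2-multipede is a finite 2-sorted structure with sorts ''segments'' and ''feet'', a function $S$ from feet to segments such that every segment is the image of exactly two feet, a family of 3-element sets of segments called hyperedges (coded as a totally irreflexive symmetric ternary relation), and a family of 3-element sets of feet called positive triples (similarly coded), such that: if $P$ is a positive triple then $S(P)$ is a hyperedge; for each hyperedge $H$, exactly four of the eight triples of feet mapped by $S$ onto $H$ are positive; and if $P,P'$ are positive with $S(P)=S(P')$ then $|P\triangle P'|$ is even. A 3-multipede is a 2-multipede together with a linear ordering $\le$ of the set of segments. A 3-multipede with a shoe has a distinguished foot (the shoe) with $S$ of the shoe the $\le$-first segment; isomorphisms must preserve the shoe. A query on unordered structures is in PTime if some polynomial time Turing machine decides it correctly on the string encoding obtained from any ordering of the input's universe. *)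

(* Defs.v *)
(* MathComp *)
From HB Require Import structures.
From mathcomp Require Import all_boot.

Set Implicit Arguments.
Unset Strict Implicit.
Unset Printing Implicit Defensive.

Definition linear_order (T : Type) (le : rel T) : Prop :=
  [/\ reflexive le, antisymmetric le, transitive le & total le].

(** * Deterministic multi-tape Turing machines with input alphabet [bool] *)

Variant direction := Left | Stay | Right.

(* [None] is the blank; [inl b] is an input letter; [inr x] is an auxiliary
   letter of the machine. *)
Notation cell aux := (option (bool + aux)).

(* Finiteness of [state] and [aux] makes [trans] a finite table. *)
Record machine := Machine {
  aux : finType;
  state : finType;
  extra_tapes : nat;
  start : state;
  halting : pred state;
  accepting : pred state;
  trans : state -> extra_tapes.+1.-tuple (cell aux) ->
          state * extra_tapes.+1.-tuple (cell aux * direction)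
}.

(* A two-way infinite tape: [before] lists the cells to the left of the head,
   nearest first, and [after] those to its right; all other cells are blank. *)
Record tape (A : Type) := Tape {
  before : seq (option A);
  scanned : option A;
  after : seq (option A)
}.

Definition tape_of_word (A : Type) (w : seq (option A)) : tape A :=
  Tape [::] (head None w) (behead w).

Definition write_move (A : Type) (t : tape A) (a : option A * direction) :
    tape A :=
  match a.2 with
  | Left => Tape (behead (before t)) (head None (before t)) (a.1 :: after t)
  | Stay => Tape (before t) a.1 (after t)
  | Right => Tape (a.1 :: before t) (head None (after t)) (behead (after t))
  end.

Record config (M : machine) := Config {
  cstate : state M;
  ctapes : (extra_tapes M).+1.-tuple (tape (bool + aux M))
}.

Definition init (M : machine) (w : seq bool) : config M :=
  Config (start M)
    [tuple if i == ord0 then tape_of_word [seq Some (inl b) | b <- w]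
           else tape_of_word [::] | i < (extra_tapes M).+1].

Definition step (M : machine) (c : config M) : config M :=
  if halting (cstate c) then c else
  let qa := trans (cstate c) (map_tuple (@scanned _) (ctapes c)) in
  Config qa.1
    [tuple write_move (tnth (ctapes c) i) (tnth qa.2 i)
    | i < (extra_tapes M).+1].

Definition run (M : machine) (w : seq bool) (t : nat) : config M :=
  iter t (@step M) (init M w).

Definition accepts (M : machine) (w : seq bool) : Prop :=
  exists t, halting (cstate (run M w t)) /\ accepting (cstate (run M w t)).

(* The bound is required for all words, not only for codes of structures. *)
Definition polynomial_time (M : machine) : Prop :=
  exists c d : nat, forall w : seq bool,
    exists2 t, t <= c * size w ^ d + c & halting (cstate (run M w t)).

(** * Finite relational structures and their string encodings *)

Record vocabulary := Vocabulary {
  symbol : Type;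
  symbols : seq symbol;
  arity : symbol -> nat
}.

Record structure (V : vocabulary) := Structure {
  univ : finType;
  holds : forall r : symbol V, (arity r).-tuple univ -> bool
}.

Fixpoint lex_tuples (T : Type) (s : seq T) (k : nat) : seq (k.-tuple T) :=
  if k is k'.+1 then [seq cons_tuple x t | x <- s, t <- lex_tuples s k']
  else [:: nil_tuple T].

(* The size of the universe in unary, then the truth table of each relation,
   tuples being listed lexicographically along the ordering [le]. *)
Definition encode (V : vocabulary) (A : structure V) (le : rel (univ A)) :
    seq bool :=
  let s := sort le (enum (univ A)) in
  nseq (size s) true ++ false ::
  flatten [seq [seq holds t | t <- lex_tuples s (arity r)] | r <- symbols V].

(* A query [Q] on instances in [I], the instance [i] being presented as the
   unordered structure [str i]. *)
Definition ptime_query (I : Type) (V : vocabulary) (str : I -> structure V)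
    (Q : I -> Prop) : Prop :=
  exists2 M : machine, polynomial_time M &
    forall (i : I) (le : rel (univ (str i))), linear_order le ->
      accepts M (encode le) <-> Q i.

(* A pair of structures as a single one: their disjoint union, with an extra
   unary relation [None] that marks the elements of the first structure. *)
Definition pair_vocabulary (V : vocabulary) : vocabulary :=
  Vocabulary (None :: map Some (symbols V))
    (fun r : option (symbol V) => if r is Some r' then arity r' else 1).

Definition pair_holds (V : vocabulary) (A B : structure V)
    (r : symbol (pair_vocabulary V)) :
    (arity r).-tuple (univ A + univ B) -> bool :=
  match r with
  | None => fun t => if thead t is inl _ then true else false
  | Some r' => fun t =>
      [exists u : (arity r').-tuple (univ A),
         holds u && (t == map_tuple inl u)] ||
      [exists u : (arity r').-tuple (univ B),
         holds u && (t == map_tuple inr u)]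
  end.

Definition pair_structure (V : vocabulary) (A B : structure V) :
    structure (pair_vocabulary V) :=
  @Structure (pair_vocabulary V) (univ A + univ B)%type (@pair_holds V A B).

(** * Multipedes *)

Record multipede2 := Multipede2 {
  segment : finType;
  foot : finType;
  segm : foot -> segment;
  hyperedges : {set {set segment}};
  positives : {set {set foot}};
  two_feet : forall s : segment, #|[set x | segm x == s]| = 2;
  card_hyperedge : forall H, H \in hyperedges -> #|H| = 3;
  card_positive : forall P, P \in positives -> #|P| = 3;
  segm_positive : forall P, P \in positives -> segm @: P \in hyperedges;
  four_positive : forall H, H \in hyperedges ->
    #|[set P in positives | segm @: P == H]| = 4;
  even_positive : forall P P', P \in positives -> P' \in positives ->
    segm @: P = segm @: P' -> ~~ odd #|(P :\: P') :|: (P' :\: P)|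
}.

Record multipede3 := Multipede3 {
  multipede2_of :> multipede2;
  seg_le : rel (segment multipede2_of);
  seg_le_linear : linear_order seg_le
}.

Record shoed_multipede3 := ShoedMultipede3 {
  multipede3_of :> multipede3;
  shoe : foot multipede3_of;
  shoe_first : forall s, seg_le (segm shoe) s
}.

Definition isomorphic (M N : shoed_multipede3) : Prop :=
  exists (f : segment M -> segment N) (g : foot M -> foot N),
    [/\ bijective f /\ bijective g,
        forall x, segm (g x) = f (segm x),
        (forall H : {set segment M}, (f @: H \in hyperedges N) = (H \in hyperedges M)) /\
        (forall P : {set foot M}, (g @: P \in positives N) = (P \in positives M)),
        forall s t, seg_le (f s) (f t) = seg_le s t
      & g (shoe M) = shoe N].

Variant multipede_symbol :=
  | SegmentSort | FootSort | SegmOf | Hyperedge | Positive | SegLe | Shoe.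

Definition multipede_vocabulary : vocabulary :=
  Vocabulary [:: SegmentSort; FootSort; SegmOf; Hyperedge; Positive; SegLe; Shoe]
    (fun r => match r with
              | SegmentSort | FootSort | Shoe => 1
              | SegmOf | SegLe => 2
              | Hyperedge | Positive => 3
              end).

(* The two sorts are unary relations, the function [segm] is given by its
   graph, and a family of 3-element sets is coded as a ternary relation, which
   is symmetric, and totally irreflexive as the sets have 3 elements. *)
Definition multipede_holds (M : shoed_multipede3)
    (r : multipede_symbol) (w : seq (segment M + foot M)) : bool :=
  match r, w with
  | SegmentSort, [:: inl _] => true
  | FootSort, [:: inr _] => true
  | SegmOf, [:: inr x; inl s] => segm x == s
  | Hyperedge, [:: inl s1; inl s2; inl s3] =>
      [set s1; s2; s3] \in hyperedges M
  | Positive, [:: inr x1; inr x2; inr x3] =>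
      [set x1; x2; x3] \in positives M
  | SegLe, [:: inl s1; inl s2] => seg_le s1 s2
  | Shoe, [:: inr x] => x == shoe M
  | _, _ => false
  end.

Definition multipede_structure (M : shoed_multipede3) :
    structure multipede_vocabulary :=
  @Structure multipede_vocabulary (segment M + foot M)%type
    (fun r t => multipede_holds r t).

Definition multipede_pair (MN : shoed_multipede3 * shoed_multipede3) :
    structure (pair_vocabulary multipede_vocabulary) :=
  pair_structure (multipede_structure MN.1) (multipede_structure MN.2).

(* Main.v *)
Require Import Defs.
From mathcomp Require Import all_boot.
From mathcomp Require Import zify.

Set Implicit Arguments.
Unset Strict Implicit.
Unset Printing Implicit Defensive.

(** The orderings fix the bijection between the segments, so an isomorphism is
    a vector [x] over F_2 saying, for each segment, whether the two feet are
    exchanged with respect to some naming of them by 0 and 1.  For three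
    segments and their images, the vectors [x] in F_2^3 that carry one set of
    triples of feet to the other form, unless there are none, a coset of the
    stabilizer of the first set: in any case the solution set of all the linear
    equations that hold on them.  Isomorphism is thus solvability of a linear system over
    F_2, decided by Gaussian elimination.  (The condition [even_positive] is
    vacuous, as P and P' both have three elements, so any four of the eight
    triples can be positive and the subspace need not be defined by a parity.)

    Polynomial time is established for functions on finite trees.  A machine
    with four stacks of bits stores a tree in prefix notation on its first
    stack, above a part that it never reads; the functions computed in this way
    in polynomial time are closed under composition, pairing, case analysis and
    folds whose intermediate values have polynomially bounded size. *)

(** * A machine with four stacks of bits *)

(** Three choices shape the reduction. Constraints are indexed by all triples of matched segments,
    repetitions included, so that one kind of constraint on three bits also carries the shoe and the
    hyperedges. The equations of a triple are found by trial: of the 16 affine equations on F_2^3,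
    those valid on all its fitting vectors are kept. A triple with no fitting vector thereby
    contributes 0 = 1. On the side of complexity, the time bound must hold on every word, encoding
    or not; all functions are therefore total, reading [false] beyond the end of the word. The bound
    on intermediate values in folds is essential, since iterating a polynomial-time function may
    square the size at every round. Gaussian elimination over F_2 is harmless in this respect:
    entries remain bits, and neither the number of rows nor their lengths increase. *)

Variant reg := RA | RB | RC | RD.

Record store := Store {
  stA : seq bool; stB : seq bool; stC : seq bool; stD : seq bool }.

Definition get (s : store) (r : reg) : seq bool :=
  match r with RA => stA s | RB => stB s | RC => stC s | RD => stD s end.

Definition upd (s : store) (r : reg) (v : seq bool) : store :=
  let: Store a b c d := s in
  match r with
  | RA => Store v b c d | RB => Store a v c d
  | RC => Store a b v d | RD => Store a b c v
  end.

(* [Pop r e f t] removes the top of [r] and skips [e], [f] or [t] instructions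
   according as [r] was empty or its top was [false] or [true]. *)
Variant instr :=
  | Push of reg & bool
  | Pop of reg & nat & nat & nat
  | Jump of nat
  | Rewind of nat
  | Halt of bool.

(** Leaving the program means halting, so every program counter has a meaning. *)
Definition fetch (C : seq instr) (pc : nat) : instr := nth (Halt false) C pc.

Definition istep (C : seq instr) (ps : nat * store) : nat * store :=
  let: (pc, s) := ps in
  match fetch C pc with
  | Push r b => (pc.+1, upd s r (b :: get s r))
  | Pop r e f t =>
      match get s r with
      | [::] => (pc.+1 + e, s)
      | b :: l => (pc.+1 + (if b then t else f), upd s r l)
      end
  | Jump k => (pc.+1 + k, s)
  | Rewind k => (pc - k, s)
  | Halt _ => (pc, s)
  end.

Definition halted (C : seq instr) (pc : nat) : bool :=
  if fetch C pc is Halt _ then true else false.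

Definition reg_index (r : reg) : 'I_4 :=
  match r with
  | RA => @Ordinal 4 0 isT | RB => @Ordinal 4 1 isT
  | RC => @Ordinal 4 2 isT | RD => @Ordinal 4 3 isT
  end.

Lemma reg_index_eq (r r' : reg) :
  reg_index r == reg_index r' -> r = r'.
Proof. by case: r r' => [] []. Qed.

(** * Simulation of stack programs by Turing machines *)

Section Simulation.

Variable C : seq instr.

Local Notation letter := (cell void).

(** All counters beyond the program behave alike and share one state, which keeps the state set
    finite. *)
Definition pc_state (pc : nat) : 'I_(size C).+1 := inord (minn pc (size C)).

Lemma pc_stateE pc : pc_state pc = minn pc (size C) :> nat.
Proof. by rewrite inordK // ltnS geq_minr. Qed.

Lemma fetch_minn pc : fetch C (minn pc (size C)) = fetch C pc.
Proof.
rewrite /fetch; case: (leqP pc (size C)) => // /ltnW le_pc.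
by rewrite !nth_default.
Qed.

Definition act_on (r : reg) (scan : 4.-tuple letter) (a : letter * direction) :
    4.-tuple (letter * direction) :=
  [tuple if i == reg_index r then a else (tnth scan i, Stay) | i < 4].

Definition idle (scan : 4.-tuple letter) : 4.-tuple (letter * direction) :=
  [tuple (tnth scan i, Stay) | i < 4].

(* The flag is set between the two halves of a [Push]: move left, then write. *)
Definition instr_trans (q : 'I_(size C).+1 * bool) (scan : 4.-tuple letter) :
    ('I_(size C).+1 * bool) * 4.-tuple (letter * direction) :=
  match fetch C q.1, q.2 with
  | Push r b, false =>
      ((q.1, true), act_on r scan (tnth scan (reg_index r), Left))
  | Push r b, true =>
      ((pc_state q.1.+1, false), act_on r scan (Some (inl b), Stay))
  | Pop r e f t, _ =>
      match tnth scan (reg_index r) with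
      | Some (inl b) =>
          ((pc_state (q.1.+1 + (if b then t else f)), false),
           act_on r scan (None, Right))
      | _ => ((pc_state (q.1.+1 + e), false), idle scan)
      end
  | Jump k, _ => ((pc_state (q.1.+1 + k), false), idle scan)
  | Rewind k, _ => ((pc_state (q.1 - k), false), idle scan)
  | Halt _, _ => (q, idle scan)
  end.

Definition instr_machine : machine :=
  @Machine void ('I_(size C).+1 * bool)%type 3 (ord0, false)
    (fun q => ~~ q.2 && halted C q.1)
    (fun q => if fetch C q.1 is Halt true then true else false)
    instr_trans.

(** [k] counts the blanked cells that pops have left behind, [j] the blanks listed beyond the bottom
    of the stack. *)
Definition stack_tape (l : seq bool) (t : tape (bool + void)) : Prop :=
  exists k j, before t = nseq k None /\
    scanned t :: after t = [seq Some (inl b) | b <- l] ++ nseq j None.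

Definition simulates (ps : nat * store) (c : config instr_machine) : Prop :=
  cstate c = (pc_state ps.1, false) /\
  forall r, stack_tape (get ps.2 r) (tnth (ctapes c) (reg_index r)).

Lemma write_move_stay (A : Type) (t : tape A) :
  write_move t (scanned t, Stay) = t.
Proof. by case: t. Qed.

Lemma stack_tape_push b l t : stack_tape l t ->
  stack_tape (b :: l)
    (write_move (write_move t (scanned t, Left)) (Some (inl b), Stay)).
Proof.
move=> [k [j [Eb Ea]]]; exists k.-1, j; rewrite /write_move /= Eb Ea.
by case: k Eb.
Qed.

Lemma stack_tape_pop b l t : stack_tape (b :: l) t ->
  stack_tape l (write_move t (None, Right)).
Proof.
move=> [k [j [Eb [Es Ea]]]]; rewrite /write_move /=; exists k.+1.
have [a0 | [x [r ar]]] : after t = [::] \/ exists x r, after t = x :: r.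
- by case: (after t) => [|x r]; [left | right; exists x, r].
(* The head leaves the listed cells and scans one fresh blank. *)
- exists 1; rewrite Eb; split=> //; move: Ea; rewrite a0 /=.
  by case: (l).
- by exists j; rewrite Eb -Ea ar.
Qed.

Lemma stack_tape_scanned l t : stack_tape l t ->
  scanned t = if l is b :: _ then Some (inl b) else None.
Proof. by move=> [k [j [_]]]; case: l => [|b l]; [case: j => [|j]|]; case. Qed.

Lemma get_upd s r r' v :
  get (upd s r v) r' = if reg_index r' == reg_index r then v else get s r'.
Proof. by case: s r r' => a b c d [] []. Qed.

Lemma simulates_halting ps c : simulates ps c ->
  halting (cstate c) = halted C ps.1.
Proof.
by case: ps => pc s [Ec _]; rewrite Ec /= /halted pc_stateE fetch_minn.
Qed.

Lemma simulates_accepting ps c : simulates ps c ->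
  accepting (cstate c) = if fetch C ps.1 is Halt true then true else false.
Proof. by case: ps => pc s [Ec _]; rewrite Ec /= pc_stateE fetch_minn. Qed.

(** A [Push] takes two machine steps, a halted program none, anything else one. *)
Lemma simulates_step ps c : simulates ps c ->
  exists2 k, k <= 2 & simulates (istep C ps) (iter k (@step _) c).
Proof.
case: ps => pc s sim; have hc := simulates_halting sim.
case: (boolP (halted C pc)) => [h | nh].
  exists 0 => //=; move: sim h; rewrite /halted /istep.
  by case: (fetch C pc).
have lt_pc : pc < size C.
  rewrite ltnNge; apply: contra nh => le_pc.
  by rewrite /halted /fetch nth_default.
case: sim => Ec rep; rewrite /= in Ec rep.
have vpc : pc_state pc = pc :> nat by rewrite pc_stateE; lia.
have stepE (c' : config instr_machine) : cstate c' = (pc_state pc, false) -> step c' =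
    let qa := @instr_trans (pc_state pc, false)
                (map_tuple (@scanned _) (ctapes c')) in
    @Config instr_machine qa.1
    [tuple write_move (tnth (ctapes c') i) (tnth qa.2 i) | i < 4].
  by move=> Ec'; rewrite /step Ec' /= vpc (negPf nh).
have idleE (c' : config instr_machine) i :
    tnth (idle (map_tuple (@scanned _) (ctapes c'))) i =
    (scanned (tnth (ctapes c') i), Stay) by rewrite tnth_mktuple tnth_map.
have scanE r :
    scanned (tnth (ctapes c) (reg_index r)) =
    if get s r is b :: _ then Some (inl b) else None.
  exact: stack_tape_scanned (rep r).
rewrite /istep; case Ei: (fetch C pc) => [r b|r e f t|k|k|b].
- exists 2 => //; rewrite [iter _ _ _]/= (stepE c Ec) /instr_trans /= vpc Ei /=.
  rewrite /step /=.
  split=> /=; first by rewrite /instr_trans /= vpc Ei.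
  move=> r'; rewrite /instr_trans /= vpc Ei /= !(tnth_mktuple, tnth_map, tnth_ord_tuple) get_upd.
  case: ifP => [/eqP Er|nr].
    by rewrite Er; apply: stack_tape_push.
  by rewrite !write_move_stay; apply: rep.
- exists 1 => //; rewrite /= (stepE c Ec) /= /instr_trans /= vpc Ei /=.
  rewrite tnth_map scanE; case Eg: (get s r) => [|b l] /=.
    split=> //= r'; rewrite tnth_mktuple idleE write_move_stay.
    exact: rep.
  split=> //= r'; rewrite !(tnth_mktuple, tnth_map, tnth_ord_tuple) get_upd.
  case: ifP => [/eqP/eqP/reg_index_eq Er|nr]; last by rewrite write_move_stay.
  by rewrite Er; apply: (@stack_tape_pop b); rewrite -Eg.
- exists 1 => //; rewrite /= (stepE c Ec) /= /instr_trans /= vpc Ei /=.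
  split=> //= r'; rewrite tnth_mktuple idleE write_move_stay; exact: rep.
- exists 1 => //; rewrite /= (stepE c Ec) /= /instr_trans /= vpc Ei /=.
  split=> //= r'; rewrite tnth_mktuple idleE write_move_stay; exact: rep.
- by move: nh; rewrite /halted Ei.
Qed.

Lemma simulates_steps n ps c : simulates ps c ->
  exists2 k, k <= 2 * n & simulates (iter n (istep C) ps) (iter k (@step _) c).
Proof.
move=> sim; elim: n => [|n [k le_k simk]]; first by exists 0.
have [k' le_k' simk'] := simulates_step simk.
by exists (k' + k); [lia | rewrite iterD].
Qed.

Lemma simulates_init w :
  simulates (0, Store w [::] [::] [::]) (init instr_machine w).
Proof.
split; first by congr pair; apply: val_inj; rewrite /= pc_stateE min0n.
case; rewrite /= tnth_mktuple /=; try by exists 0, 1.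
by case: w => [|b w]; [exists 0, 1 | exists 0, 0; rewrite /= cats0].
Qed.

End Simulation.

Lemma step_halting (M : machine) (c : config M) n :
  halting (cstate c) -> iter n (@step M) c = c.
Proof. by move=> h; elim: n => //= n ->; rewrite /step h. Qed.

Lemma run_halting_unique (M : machine) w t t' :
  halting (cstate (run M w t)) -> halting (cstate (run M w t')) ->
  run M w t = run M w t'.
Proof.
wlog le_t : t t' / t <= t' => [hw h h'|h _].
  by case: (leqP t t') => [/hw|/ltnW/hw] -> //.
by rewrite -(subnK le_t) [RHS]/run iterD step_halting.
Qed.

(** One halting time with the right verdict settles both directions of acceptance, since a halted
    configuration no longer changes. *)
Lemma instr_machine_decides (C : seq instr) (D : seq bool -> bool)
    (T : seq bool -> nat) :
  (forall w, exists2 t, t <= T w & exists pc s,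
     iter t (istep C) (0, Store w [::] [::] [::]) = (pc, s) /\
     fetch C pc = Halt (D w)) ->
  (forall w, exists2 t, t <= 2 * T w & halting (cstate (run (instr_machine C) w t)))
  /\ forall w, accepts (instr_machine C) w <-> D w.
Proof.
move=> runC.
have halts w : exists2 t, t <= 2 * T w &
    halting (cstate (run (instr_machine C) w t)) /\
    accepting (cstate (run (instr_machine C) w t)) = D w.
  have [t le_t [pc [s [Et Ef]]]] := runC w.
  have [k le_k simk] := simulates_steps t (simulates_init C w).
  exists k; first lia.
  rewrite (simulates_halting simk) (simulates_accepting simk) Et /halted /= Ef.
  by case: (D w).
split=> w; have [t le_t [ht at_]] := halts w; first by exists t.
split=> [[t' [ht' at']]|Dw]; last by exists t; rewrite at_.
by rewrite -at_ (run_halting_unique ht ht').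
Qed.

(** * Program fragments and control structures *)

Arguments fetch : simpl never.
(* Jumps are relative, so [c] may be placed anywhere in the program. *)
Definition runs (c : seq instr) (s : store) (t : nat) (s' : store) : Prop :=
  forall C1 C2, iter t (istep (C1 ++ c ++ C2)) (size C1, s) =
                (size C1 + size c, s').

Lemma runs_nil s : runs [::] s 0 s.
Proof. by move=> C1 C2; rewrite addn0. Qed.

Lemma runs_cat c1 c2 s s1 s2 t1 t2 :
  runs c1 s t1 s1 -> runs c2 s1 t2 s2 -> runs (c1 ++ c2) s (t1 + t2) s2.
Proof.
move=> h1 h2 C1 C2; rewrite addnC iterD -catA h1.
have := h2 (C1 ++ c1) C2; rewrite !size_cat -!catA => ->.
by rewrite addnA.
Qed.

Ltac norm_cat := repeat first [done | progress rewrite /= | rewrite -!catA].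
Ltac norm_size := repeat first [rewrite size_cat /= | progress rewrite /=]; lia.

Lemma runs_run c s t s' C pc C1 C2 : runs c s t s' ->
  C = C1 ++ c ++ C2 -> pc = size C1 ->
  iter t (istep C) (pc, s) = (pc + size c, s').
Proof. by move=> h -> ->. Qed.

Lemma fetch_at C pc C1 i C2 :
  C = C1 ++ i :: C2 -> pc = size C1 -> fetch C pc = i.
Proof. by move=> -> ->; rewrite /fetch nth_cat ltnn subnn. Qed.

Lemma runs_push r b s : runs [:: Push r b] s 1 (upd s r (b :: get s r)).
Proof. by move=> C1 C2; rewrite /= (fetch_at (C1 := C1) erefl) // addn1. Qed.

Lemma runs_pop r b l s : get s r = b :: l ->
  runs [:: Pop r 0 0 0] s 1 (upd s r l).
Proof.
by move=> E C1 C2; rewrite /= (fetch_at (C1 := C1) erefl) //= E addn1 if_same addn0.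
Qed.

(** The [.+1] jumps over the [Jump] that closes [c0]. An empty stack is treated like [false]. *)
Definition case_code r (c0 c1 : seq instr) : seq instr :=
  Pop r 0 0 (size c0).+1 :: c0 ++ Jump (size c1) :: c1.

Lemma runs_case_false r c0 c1 s s' l t : get s r = false :: l ->
  runs c0 (upd s r l) t s' -> runs (case_code r c0 c1) s t.+2 s'.
Proof.
rewrite /case_code; set i0 := Pop _ _ _ _ => E h C1 C2.
rewrite iterS iterSr [istep _ (size C1, s)]/= (fetch_at (C1 := C1) erefl) //= E addn0.
rewrite (runs_run (C1 := C1 ++ [:: i0]) (C2 := Jump (size c1) :: c1 ++ C2) h);
  [|norm_cat|norm_size].
rewrite /= (fetch_at (i := Jump (size c1)) (C1 := C1 ++ i0 :: c0) (C2 := c1 ++ C2));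
  [|norm_cat|norm_size].
congr pair; norm_size.
Qed.

Lemma runs_case_true r c0 c1 s s' l t : get s r = true :: l ->
  runs c1 (upd s r l) t s' -> runs (case_code r c0 c1) s t.+1 s'.
Proof.
rewrite /case_code; set i0 := Pop _ _ _ _ => E h C1 C2.
rewrite iterSr [istep _ (size C1, s)]/= (fetch_at (C1 := C1) erefl) //= E.
rewrite (runs_run (C1 := C1 ++ i0 :: c0 ++ [:: Jump (size c1)]) (C2 := C2) h);
  [|norm_cat|norm_size].
congr pair; norm_size.
Qed.

Definition while_code r (c : seq instr) : seq instr :=
  Pop r (size c).+1 (size c).+1 0 :: c ++ [:: Rewind (size c).+1].

Lemma runs_while_nil r c s : get s r = [::] -> runs (while_code r c) s 1 s.
Proof.
move=> E C1 C2; rewrite /= (fetch_at (C1 := C1) erefl) //= E.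
congr pair; norm_size.
Qed.

Lemma runs_while_false r c s l : get s r = false :: l ->
  runs (while_code r c) s 1 (upd s r l).
Proof.
move=> E C1 C2; rewrite /= (fetch_at (C1 := C1) erefl) //= E.
congr pair; norm_size.
Qed.

(** The remaining rounds enter as a hypothesis, so that loops are verified by induction on their
    data; the 2 pays for the [Pop] and the [Rewind]. *)
Lemma runs_while_true r c s l s1 s2 t1 t2 : get s r = true :: l ->
  runs c (upd s r l) t1 s1 -> runs (while_code r c) s1 t2 s2 ->
  runs (while_code r c) s (t2 + t1.+2) s2.
Proof.
move=> E h1 h2 C1 C2; have := h2 C1 C2; rewrite {1 3}/while_code.
set i0 := Pop _ _ _ _; set C := C1 ++ _ => {}h2.
rewrite iterD iterS iterSr [istep _ (size C1, s)]/= (fetch_at (C1 := C1) erefl) //= E addn0.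
rewrite (runs_run (C1 := C1 ++ [:: i0]) (C2 := Rewind (size c).+1 :: C2) h1);
  [|rewrite /C; norm_cat|norm_size].
rewrite [istep _ (_, s1)]/= (fetch_at (i := Rewind (size c).+1) (C1 := C1 ++ i0 :: c) (C2 := C2));
  [|rewrite /C; norm_cat|norm_size].
by rewrite (_ : _ - _ = size C1) //; lia.
Qed.

(** Unlike [while_code], this stops only on the empty stack: it consumes all of [r], one branch per
    bit. *)
Definition loop_code r (c0 c1 : seq instr) : seq instr :=
  Pop r (size c0 + size c1).+2 0 (size c0).+1 ::
    c0 ++ Rewind (size c0).+1 :: c1 ++ [:: Rewind (size c0 + size c1).+2].

Lemma runs_loop_nil r c0 c1 s : get s r = [::] -> runs (loop_code r c0 c1) s 1 s.
Proof.
move=> E C1 C2; rewrite /= (fetch_at (C1 := C1) erefl) //= E.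
congr pair; norm_size.
Qed.

Lemma runs_loop_cons r c0 c1 s b l s1 s2 t1 t2 : get s r = b :: l ->
  runs (if b then c1 else c0) (upd s r l) t1 s1 ->
  runs (loop_code r c0 c1) s1 t2 s2 ->
  runs (loop_code r c0 c1) s (t2 + t1.+2) s2.
Proof.
move=> E h1 h2 C1 C2; have := h2 C1 C2; rewrite {1 3}/loop_code.
set i0 := Pop _ _ _ _; set C := C1 ++ _ => {}h2.
rewrite iterD iterS iterSr [istep _ (size C1, s)]/= (fetch_at (C1 := C1) erefl) //= E.
case: b E h1 => E h1.
- rewrite (runs_run (C1 := C1 ++ i0 :: c0 ++ [:: Rewind (size c0).+1])
    (C2 := Rewind (size c0 + size c1).+2 :: C2) h1); [|rewrite /C; norm_cat|norm_size].
  rewrite [istep _ (_, s1)]/= (fetch_at (i := Rewind (size c0 + size c1).+2)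
    (C1 := C1 ++ i0 :: c0 ++ Rewind (size c0).+1 :: c1) (C2 := C2));
    [|rewrite /C; norm_cat|norm_size].
  by rewrite (_ : _ - _ = size C1) //; lia.
- rewrite (runs_run (C1 := C1 ++ [:: i0])
    (C2 := Rewind (size c0).+1 :: c1 ++ Rewind (size c0 + size c1).+2 :: C2) h1);
    [|rewrite /C; norm_cat|norm_size].
  rewrite [istep _ (_, s1)]/= (fetch_at (i := Rewind (size c0).+1)
    (C1 := C1 ++ i0 :: c0) (C2 := c1 ++ Rewind (size c0 + size c1).+2 :: C2));
    [|rewrite /C; norm_cat|norm_size].
  by rewrite (_ : _ - _ = size C1) //; lia.
Qed.

Definition store_size (s : store) : nat :=
  size (stA s) + size (stB s) + size (stC s) + size (stD s).

Lemma istep_size C ps : store_size (istep C ps).2 <= (store_size ps.2).+1.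
Proof.
case: ps => pc [a b c d]; rewrite /istep.
case: (fetch C pc) => [r x|r e f t|k|k|x] //=;
  rewrite /store_size; try by case: r => /=; lia.
by case: r => /=; [case: a | case: b | case: c | case: d] => * /=; lia.
Qed.

(** An instruction adds at most one bit. Running time thus bounds output length, on which composing
    polynomial bounds relies. *)
Lemma runs_size c s t s' : runs c s t s' -> store_size s' <= store_size s + t.
Proof.
move=> /(_ [::] [::]) /(congr1 (fun ps => store_size ps.2)) /= <-.
elim: t => [|t IH]; first by rewrite addn0.
by apply: leq_trans (istep_size _ _) _; rewrite addnS ltnS.
Qed.

(** * Trees on a stack *)

Inductive tree := Leaf | Node of tree & tree.

Fixpoint enc (v : tree) : seq bool :=
  if v is Node v1 v2 then true :: enc v1 ++ enc v2 else [:: false].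

Lemma enc_gt0 v : 0 < size (enc v).
Proof. by case: v. Qed.

Definition pour r r' : seq instr := loop_code r [:: Push r' false] [:: Push r' true].

Lemma runs_pour r r' s : reg_index r != reg_index r' ->
  runs (pour r r') s (3 * size (get s r)).+1
    (upd (upd s r' (rev (get s r) ++ get s r')) r [::]).
Proof.
move=> nr; move E: (get s r) => l.
elim: l s E => [|x l IH] s E.
  have -> : upd (upd s r' (rev [::] ++ get s r')) r [::] = s.
    by rewrite /= -E; case: s r r' nr {E} => a b c d [] [].
  exact: runs_loop_nil.
rewrite (_ : (3 * _).+1 = (3 * size l).+1 + 1.+2) /=; last by lia.
apply: (runs_loop_cons (l := l) E (s1 := upd (upd s r l) r' (x :: get s r'))).
  have -> : get s r' = get (upd s r l) r'.
    by rewrite get_upd eq_sym (negPf nr).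
  by case: (x); apply: runs_push.
set s1 := upd _ _ _; have E1 : get s1 r = l.
  by rewrite get_upd (negPf nr) get_upd eqxx.
have := IH s1 E1; rewrite (_ : upd (upd s1 _ _) _ _ = upd (upd s r' (rev (x :: l) ++ get s r')) r [::]) //.
rewrite rev_cons cat_rcons /s1.
by case: s r r' nr {IH E E1 s1} => a b c d [] [].
Qed.

Definition within (c : seq instr) (s : store) (T : nat) (s' : store) : Prop :=
  exists2 t, t <= T & runs c s t s'.

Lemma runs_within c s t s' : runs c s t s' -> within c s t s'.
Proof. by exists t. Qed.

Lemma within_leq c s T T' s' : T <= T' -> within c s T s' -> within c s T' s'.
Proof. by move=> le_T [t le_t h]; exists t => //; lia. Qed.

Lemma within_cat c1 c2 s s1 s2 T1 T2 :
  within c1 s T1 s1 -> within c2 s1 T2 s2 -> within (c1 ++ c2) s (T1 + T2) s2.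
Proof.
by move=> [t1 le1 h1] [t2 le2 h2]; exists (t1 + t2); [lia | exact: runs_cat h1 h2].
Qed.

Lemma within_push r b s : within [:: Push r b] s 1 (upd s r (b :: get s r)).
Proof. exact/runs_within/runs_push. Qed.

Lemma within_pop r b l s : get s r = b :: l ->
  within [:: Pop r 0 0 0] s 1 (upd s r l).
Proof. by move=> E; apply/runs_within/(runs_pop E). Qed.

Lemma within_case_false r c0 c1 s s' l T : get s r = false :: l ->
  within c0 (upd s r l) T s' -> within (case_code r c0 c1) s T.+2 s'.
Proof. by move=> E [t le_t h]; exists t.+2; [lia | exact: runs_case_false E h]. Qed.

Lemma within_case_true r c0 c1 s s' l T : get s r = true :: l ->
  within c1 (upd s r l) T s' -> within (case_code r c0 c1) s T.+1 s'.
Proof. by move=> E [t le_t h]; exists t.+1; [lia | exact: runs_case_true E h]. Qed.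

Lemma within_while_false r c s l : get s r = false :: l ->
  within (while_code r c) s 1 (upd s r l).
Proof. by move=> E; apply/runs_within/runs_while_false. Qed.

Lemma within_while_true r c s l s1 s2 T1 T2 : get s r = true :: l ->
  within c (upd s r l) T1 s1 -> within (while_code r c) s1 T2 s2 ->
  within (while_code r c) s (T2 + T1.+2) s2.
Proof.
move=> E [t1 le1 h1] [t2 le2 h2].
by exists (t2 + t1.+2); [lia | exact: runs_while_true E h1 h2].
Qed.

Lemma within_pour r r' s : reg_index r != reg_index r' ->
  within (pour r r') s (3 * size (get s r)).+1
    (upd (upd s r' (rev (get s r) ++ get s r')) r [::]).
Proof. by move=> nr; apply/runs_within/runs_pour. Qed.

Definition parse_loop r : seq instr :=
  while_code RD (case_code RA [:: Push r false]
                   ([:: Push r true] ++ [:: Push RD true] ++ [:: Push RD true])).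

(* [RD] counts in unary the subtrees still to be read. *)
Definition move_tree r : seq instr := [:: Push RD true] ++ parse_loop r.

(* [x] is the stack that receives the tree, [y] the remaining one. *)
Definition target (second : bool) := if second then RC else RB.
Definition target_store (second : bool) a x y d :=
  if second then Store a y x d else Store a x y d.

(** A node replaces one pending subtree by two, a leaf removes one. The rest of the run is an
    arbitrary continuation, so that the hypothesis for [v1] applies to the run that goes on with
    [v2]. Each bit costs at most 6 steps. *)
Lemma within_parse second v a x y n T s' :
  within (parse_loop (target second))
    (target_store second a (rev (enc v) ++ x) y n) T s' ->
  within (parse_loop (target second))
    (target_store second (enc v ++ a) x y (true :: n)) (T + 6 * size (enc v)) s'.
Proof.
elim: v a x n T s' => [|v1 IH1 v2 IH2] a x n T s' h.
  apply: within_leq (within_while_true (T1 := 3) _ _ h); first by rewrite /=; lia.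
    by case: second h.
  case: second h => h; exact: within_case_false (within_push _ _ _).
have {}h : within (parse_loop (target second))
    (target_store second (enc v1 ++ enc v2 ++ a) (true :: x) y [:: true, true & n])
    (T + 6 * size (enc v2) + 6 * size (enc v1)) s'.
  apply: IH1; apply: IH2.
  by move: h; rewrite /= rev_cons rev_cat cat_rcons -!catA.
clear IH1 IH2.
apply: within_leq (within_while_true (l := n) (T1 := 4) _ _ h).
- by rewrite /= size_cat; lia.
- by case: second h.
- case: second h => h;
  apply: (@within_case_true _ _ _ _ _ (enc v1 ++ enc v2 ++ a) 3);
  rewrite ?catA //; rewrite -!catA /=;
  apply: (within_cat (T1 := 1) (within_push _ _ _));
  exact: (within_cat (T1 := 1) (within_push _ _ _) (within_push _ _ _)).
Qed.

Lemma within_move_tree second v a x y :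
  within (move_tree (target second)) (target_store second (enc v ++ a) x y [::])
    (2 + 6 * size (enc v)) (target_store second a (rev (enc v) ++ x) y [::]).
Proof.
apply: within_leq (within_cat (T1 := 1) (T2 := 1 + 6 * size (enc v)) (within_push _ _ _) _).
  by lia.
have := @within_parse second v a x y [::] 1.
case: second => /= h; apply: h; exists 1 => //; exact: runs_while_nil.
Qed.

Definition value_store a := Store a [::] [::] [::].

(** The trees lie reversed on separate stacks; emptying [RB] first puts [v1] underneath, and pouring
    undoes the reversal. *)
Definition swap_code : seq instr :=
  move_tree RB ++ move_tree RC ++ pour RB RA ++ pour RC RA.

Lemma within_swap v1 v2 a :
  within swap_code (value_store (enc v1 ++ enc v2 ++ a))
    (6 + 9 * (size (enc v1) + size (enc v2))) (value_store (enc v2 ++ enc v1 ++ a)).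
Proof.
apply: within_leq (within_cat (@within_move_tree false v1 _ _ _)
  (within_cat (@within_move_tree true v2 _ _ _)
  (within_cat (@within_pour RB RA _ isT) _))); last first.
  have := @within_pour RC RA (Store (enc v1 ++ a) [::] (rev (enc v2)) [::]) isT.
  by rewrite /= !cats0 !revK; apply.
rewrite /= !cats0 !size_rev; lia.
Qed.

(** The loop restores the tree on [RA] and leaves a copy on [RC] in reading order; pouring it twice
    keeps that order. *)
Definition dup_code : seq instr :=
  move_tree RB ++
  loop_code RB ([:: Push RA false] ++ [:: Push RC false])
               ([:: Push RA true] ++ [:: Push RC true]) ++
  pour RC RB ++ pour RB RA.

Lemma within_dup v a :
  within dup_code (value_store (enc v ++ a)) (20 + 20 * size (enc v))
    (value_store (enc v ++ enc v ++ a)).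
Proof.
have copy l a' c' : within (loop_code RB ([:: Push RA false] ++ [:: Push RC false])
               ([:: Push RA true] ++ [:: Push RC true]))
    (Store a' l c' [::]) (1 + 4 * size l) (Store (rev l ++ a') [::] (rev l ++ c') [::]).
  elim: l a' c' => [|b l IH] a' c'; first by exists 1 => //; apply: runs_loop_nil.
  rewrite rev_cons !cat_rcons.
  have [t le_t h] := IH (b :: a') (b :: c').
  exists (t + 2.+2); first by rewrite /=; lia.
  apply: (runs_loop_cons (b := b) (l := l)) h => //.
  by case: b; apply: (runs_cat (t1 := 1) (t2 := 1) (runs_push _ _ _) (runs_push _ _ _)).
apply: within_leq (within_cat (@within_move_tree false v _ _ _)
  (within_cat (copy _ _ _) (within_cat (@within_pour RC RB _ isT) _))); last first.
  have := @within_pour RB RA (Store (enc v ++ a) (rev (enc v)) [::] [::]) isT.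
  by rewrite /= !cats0 !revK; apply.
rewrite /= !cats0 !size_rev; lia.
Qed.

Definition drop_code : seq instr := move_tree RB ++ loop_code RB [::] [::].

Lemma within_drop v a :
  within drop_code (value_store (enc v ++ a)) (10 + 10 * size (enc v))
    (value_store a).
Proof.
have clear l : within (loop_code RB [::] [::])
    (Store a l [::] [::]) (1 + 2 * size l) (value_store a).
  elim: l => [|b l [t le_t h]]; first by exists 1 => //; apply: runs_loop_nil.
  exists (t + 0.+2); first by rewrite /=; lia.
  by apply: (runs_loop_cons (b := b) (l := l)) h => //; case: b; apply: runs_nil.
apply: within_leq (within_cat (@within_move_tree false v _ _ _) (clear _)).
by rewrite cats0 size_rev; lia.
Qed.

(** * Polynomial-time functions *)

(* [to_tree] need not be injective, and lists share the code of pairs, natural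
   numbers that of lists over [unit]. *)
Class data (A : Type) := to_tree : A -> tree.

#[export] Instance data_unit : data unit := fun=> Leaf.
#[export] Instance data_bool : data bool :=
  fun b => if b then Node Leaf Leaf else Leaf.
#[export] Instance data_nat : data nat := fun n => iter n (Node Leaf) Leaf.
#[export] Instance data_prod A B {dA : data A} {dB : data B} : data (A * B) :=
  fun p => Node (to_tree p.1) (to_tree p.2).
#[export] Instance data_seq A {dA : data A} : data (seq A) :=
  foldr (fun x => Node (to_tree x)) Leaf.

Definition code {A} {dA : data A} (x : A) : seq bool := enc (to_tree x).
Definition code_size {A} {dA : data A} (x : A) : nat := size (code x).

Arguments to_tree : simpl never.
Arguments code : simpl never.
Arguments code_size : simpl never.

Lemma code_size_gt0 A {dA : data A} (x : A) : 0 < code_size x.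
Proof. exact: enc_gt0. Qed.

Lemma code_size_bool (b : bool) : code_size b <= 3.
Proof. by case: b. Qed.

Lemma code_pair A B {dA : data A} {dB : data B} (x : A) (y : B) :
  code (x, y) = true :: code x ++ code y.
Proof. by []. Qed.

Lemma code_cons A {dA : data A} (x : A) (l : seq A) :
  code (x :: l) = true :: code x ++ code l.
Proof. by []. Qed.

Lemma code_size_nat (n : nat) : code_size n = n.*2.+1.
Proof.
elim: n => // n IH; rewrite /code_size (_ : code n.+1 = true :: false :: code n) //=.
by rewrite -/(code_size n) IH doubleS.
Qed.

Lemma code_size_pair A B {dA : data A} {dB : data B} (p : A * B) :
  code_size p = (code_size p.1 + code_size p.2).+1.
Proof. by case: p => x y; rewrite /code_size code_pair /= size_cat. Qed.

Lemma code_size_cons A {dA : data A} (x : A) (l : seq A) :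
  code_size (x :: l) = (code_size x + code_size l).+1.
Proof. by rewrite /code_size code_cons /= size_cat. Qed.

Lemma code_size_nil A {dA : data A} : code_size ([::] : seq A) = 1.
Proof. by []. Qed.

Lemma code_size_cat A {dA : data A} (l1 l2 : seq A) :
  (code_size (l1 ++ l2)).+1 = code_size l1 + code_size l2.
Proof.
by elim: l1 => [|x l IH]; rewrite ?code_size_nil // cat_cons !code_size_cons -addnS IH; lia.
Qed.

Lemma code_size_take A {dA : data A} k (l : seq A) : code_size (take k l) <= code_size l.
Proof.
rewrite -[in leqRHS](cat_take_drop k l) -ltnS code_size_cat -addn1 leq_add2l.
exact: code_size_gt0.
Qed.

Lemma code_size_behead A {dA : data A} (l : seq A) : code_size (behead l) <= code_size l.
Proof. by case: l => //= x l; rewrite code_size_cons; lia. Qed.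

Lemma size_leq_sz A {dA : data A} (l : seq A) : size l <= code_size l.
Proof. by elim: l => // x l IH; rewrite code_size_cons /=; lia. Qed.

(** * Polynomial bounds in the size of the code *)

Lemma leq_exp_base m n d : m <= n -> m ^ d <= n ^ d.
Proof. by move=> le_mn; elim: d => // d IH; rewrite !expnS leq_mul. Qed.

(** A monomial is enough: codes have positive length, so it absorbs constants and lower powers. *)
Definition poly_bounded {A} {dA : data A} (F : A -> nat) : Prop :=
  exists c d, forall x, F x <= c * code_size x ^ d.

Section PolyBounded.

Context {A : Type} {dA : data A}.

Lemma poly_bounded_leq (F G : A -> nat) : (forall x, F x <= G x) -> poly_bounded G -> poly_bounded F.
Proof. by move=> le_FG [c [d h]]; exists c, d => x; apply: leq_trans (h x). Qed.

Lemma poly_bounded_const n : poly_bounded (fun _ : A => n).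
Proof. by exists n, 0 => x; rewrite muln1. Qed.

Lemma poly_bounded_sz : poly_bounded (fun x : A => code_size x).
Proof. by exists 1, 1 => x; rewrite mul1n expn1. Qed.

Lemma poly_bounded_add (F G : A -> nat) : poly_bounded F -> poly_bounded G -> poly_bounded (fun x => F x + G x).
Proof.
move=> [c [d h]] [c' [d' h']]; exists (c + c'), (d + d') => x.
rewrite mulnDl; apply: leq_add.
  by apply: leq_trans (h x) _; rewrite leq_mul2l leq_pexp2l ?orbT ?code_size_gt0 ?leq_addr.
by apply: leq_trans (h' x) _; rewrite leq_mul2l leq_pexp2l ?orbT ?code_size_gt0 ?leq_addl.
Qed.

Lemma poly_bounded_mul (F G : A -> nat) : poly_bounded F -> poly_bounded G -> poly_bounded (fun x => F x * G x).
Proof.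
move=> [c [d h]] [c' [d' h']]; exists (c * c'), (d + d') => x.
by rewrite expnD mulnACA leq_mul.
Qed.

Lemma poly_bounded_exp (F : A -> nat) d : poly_bounded F -> poly_bounded (fun x => F x ^ d).
Proof.
move=> hF; elim: d => [|d IH]; first exact: poly_bounded_const.
by apply: poly_bounded_leq (poly_bounded_mul hF IH) => x; rewrite expnS.
Qed.

Lemma poly_bounded_comp B {dB : data B} (F : B -> nat) (h : A -> B) :
  poly_bounded F -> poly_bounded (fun x => code_size (h x)) -> poly_bounded (fun x => F (h x)).
Proof.
move=> [c [d hF]] hh.
apply: poly_bounded_leq (poly_bounded_mul (poly_bounded_const c) (poly_bounded_exp d hh)) => x; exact: hF.
Qed.

End PolyBounded.

(** * Composition, pairing and case analysis in polynomial time *)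

Definition polytime {A B} {dA : data A} {dB : data B} (f : A -> B) : Prop :=
  exists c : seq instr, exists2 T : A -> nat, poly_bounded T &
    forall x rest, within c (value_store (code x ++ rest)) (T x)
                            (value_store (code (f x) ++ rest)).

Lemma polytime_sz A B {dA : data A} {dB : data B} (f : A -> B) :
  polytime f -> poly_bounded (fun x => code_size (f x)).
Proof.
move=> [c [T hT h]].
apply: poly_bounded_leq (poly_bounded_add (poly_bounded_sz) hT) => x.
have [t le_t /runs_size] := h x [::].
rewrite /store_size /= !cats0 !addn0 /code_size => le_s.
by apply: leq_trans le_s _; rewrite leq_add2l.
Qed.

(** Programs see only trees, so functions whose values have equal trees are interchangeable even
    across types. This turns cons and successor into pairing. *)
Lemma polytime_recode A B B' {dA : data A} {dB : data B} {dB' : data B'}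
    (f : A -> B) (f' : A -> B') :
  (forall x, to_tree (f x) = to_tree (f' x)) -> polytime f -> polytime f'.
Proof. by move=> e [c [T hT h]]; exists c, T => // x rest; rewrite /code -e; apply: h. Qed.

Lemma polytime_ext A B {dA : data A} {dB : data B} (f f' : A -> B) :
  f =1 f' -> polytime f -> polytime f'.
Proof. by move=> e; apply: polytime_recode => x; rewrite e. Qed.

Lemma polytime_comp A B C {dA : data A} {dB : data B} {dC : data C}
    (f : B -> C) (g : A -> B) : polytime f -> polytime g -> polytime (fun x => f (g x)).
Proof.
move=> [cf [Tf hTf hf]] hg; have sg := polytime_sz hg; move: hg => [cg [Tg hTg hg]].
exists (cg ++ cf), (fun x => Tg x + Tf (g x)).
  by apply: poly_bounded_add => //; apply: poly_bounded_comp sg.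
by move=> x rest; apply: within_cat (hg x rest) (hf (g x) rest).
Qed.

Lemma polytime_id A {dA : data A} : polytime (fun x : A => x).
Proof.
exists [::], (fun=> 0); first exact: poly_bounded_const.
by move=> x rest; exists 0 => //; apply: runs_nil.
Qed.

Lemma within_push_seq l a : within [seq Push RA b | b <- rev l] (value_store a) (size l)
  (value_store (l ++ a)).
Proof.
elim: l a => [|b l IH] a; first by exists 0 => //; apply: runs_nil.
rewrite rev_cons map_rcons -cats1.
apply: within_leq (within_cat (IH a) (within_push _ _ _)).
by rewrite /= addn1.
Qed.

Lemma polytime_const A B {dA : data A} {dB : data B} (y : B) : polytime (fun _ : A => y).
Proof.
exists (drop_code ++ [seq Push RA b | b <- rev (code y)]),
  (fun x => 10 + 10 * code_size x + code_size y).
  apply: poly_bounded_add (poly_bounded_const _); apply: poly_bounded_add (poly_bounded_const _) _.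
  exact: poly_bounded_mul (poly_bounded_const _) (poly_bounded_sz).
move=> x rest; exact: within_cat (within_drop _ _) (within_push_seq _ _).
Qed.

(** [g] runs while a copy of the input waits underneath, then [f] runs above the finished [g x];
    both rely on [rest] being arbitrary. The last push is the tag of the pair. *)
Lemma polytime_pair A B C {dA : data A} {dB : data B} {dC : data C}
    (f : A -> B) (g : A -> C) : polytime f -> polytime g -> polytime (fun x => (f x, g x)).
Proof.
move=> [cf [Tf hTf hf]] hg; have sg := polytime_sz hg; move: hg => [cg [Tg hTg hg]].
exists (dup_code ++ cg ++ swap_code ++ cf ++ [:: Push RA true]),
  (fun x => 20 + 20 * code_size x + (Tg x + (6 + 9 * (code_size (g x) + code_size x) + (Tf x + 1)))).
  have c n := @poly_bounded_const _ dA n.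
  by do ![apply: poly_bounded_add | apply: poly_bounded_mul | exact: c | exact: poly_bounded_sz | assumption].
move=> x rest.
apply: within_cat (within_dup _ _) _.
apply: within_cat (hg _ _) _.
apply: within_cat (within_swap _ _ _) _.
apply: within_cat (hf _ _) _.
by rewrite code_pair /= -catA; apply: within_push.
Qed.

Lemma polytime_cons A B {dA : data A} {dB : data B} (f : A -> B) (g : A -> seq B) :
  polytime f -> polytime g -> polytime (fun x => f x :: g x).
Proof. by move=> hf hg; apply: polytime_recode (polytime_pair hf hg). Qed.

Lemma polytime_succ A {dA : data A} (f : A -> nat) : polytime f -> polytime (fun x => (f x).+1).
Proof. by move=> hf; apply: polytime_recode (polytime_pair (polytime_const tt) hf). Qed.

Lemma within_push_code b l :
  within [:: Push RA b] (value_store l) 1 (value_store (b :: l)).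
Proof. exact: within_push. Qed.

Definition pop_code := [:: Pop RA 0 0 0].

Lemma within_pop_code b l :
  within pop_code (value_store (b :: l)) 1 (value_store l).
Proof. exact: (@within_pop RA b l (value_store (b :: l))). Qed.

Lemma polytime_fst A B C {dA : data A} {dB : data B} {dC : data C} (f : A -> B * C) :
  polytime f -> polytime (fun x => (f x).1).
Proof.
apply: polytime_comp; exists (pop_code ++ swap_code ++ drop_code),
  (fun p : B * C => 1 + ((6 + 9 * (code_size p + code_size p)) + (10 + 10 * code_size p))).
  have c n := @poly_bounded_const (B * C) _ n.
  by do ![apply: poly_bounded_add | apply: poly_bounded_mul | exact: c | exact: poly_bounded_sz].
move=> [x y] rest; rewrite code_pair /= -catA.
apply: within_leq (within_cat (within_pop_code _ _)
  (within_cat (within_swap _ _ _) (within_drop _ _))).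
by rewrite code_size_pair -/(code x) -/(code y) -/(code_size x) -/(code_size y) /=; lia.
Qed.

Lemma polytime_snd A B C {dA : data A} {dB : data B} {dC : data C} (f : A -> B * C) :
  polytime f -> polytime (fun x => (f x).2).
Proof.
apply: polytime_comp; exists (pop_code ++ drop_code),
  (fun p : B * C => 1 + (10 + 10 * code_size p)).
  have c n := @poly_bounded_const (B * C) _ n.
  by do ![apply: poly_bounded_add | apply: poly_bounded_mul | exact: c | exact: poly_bounded_sz].
move=> [x y] rest; rewrite code_pair /= -catA.
apply: within_leq (within_cat (within_pop_code _ _) (within_drop _ _)).
by rewrite code_size_pair -/(code x) -/(code_size x) /=; lia.
Qed.

(** The code of [true] has three bits, of which the branching reads the first; the two pops discard
    the others. The code of [false] is a single bit. *)
Lemma polytime_if A B {dA : data A} {dB : data B} (b : A -> bool) (f g : A -> B) :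
  polytime b -> polytime f -> polytime g -> polytime (fun x => if b x then f x else g x).
Proof.
move=> [cb [Tb hTb hb]] [cf [Tf hTf hf]] [cg [Tg hTg hg]].
exists (dup_code ++ cb ++ case_code RA cg (pop_code ++ pop_code ++ cf)),
  (fun x => 20 + 20 * code_size x + (Tb x + (4 + (Tf x + Tg x)))).
  have c n := @poly_bounded_const _ dA n.
  by do ![apply: poly_bounded_add | apply: poly_bounded_mul | exact: c | exact: poly_bounded_sz | assumption].
move=> x rest.
apply: within_cat (within_dup _ _) _.
apply: within_cat (hb _ _) _.
case: (b x).
- apply: (@within_leq _ _ (1 + (1 + Tf x)).+1); first lia.
  apply: within_case_true; first reflexivity.
  apply: within_cat (within_pop_code _ _) _.
  apply: within_cat (within_pop_code _ _) _; exact: hf.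
- apply: (@within_leq _ _ (Tg x).+2); first lia.
  by apply: within_case_false; [reflexivity | apply: hg].
Qed.

(** Once the tag of a nonempty list is read, head and tail lie side by side, and pushing [true]
    makes them a pair; a swap then brings up the saved [x] to form the argument of [g]. *)
Lemma polytime_list_case A B C {dA : data A} {dB : data B} {dC : data C}
    (l : A -> seq B) (f : A -> C) (g : A -> B -> seq B -> C) :
  polytime l -> polytime f -> polytime (fun p : A * (B * seq B) => g p.1 p.2.1 p.2.2) ->
  polytime (fun x => if l x is y :: s then g x y s else f x).
Proof.
move=> hl; have sl := polytime_sz hl; move: hl => [cl [Tl hTl hl]].
move=> [cf [Tf hTf hf]] [cg [Tg hTg hg]].
pose Tg' x := if l x is y :: s then Tg (x, (y, s)) else 0.
have hTg' : poly_bounded Tg'.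
  case: hTg => c [d hTg].
  apply: poly_bounded_leq (_ : poly_bounded (fun x => c * (code_size x + code_size (l x) + 1) ^ d)).
    move=> x; rewrite /Tg'; case: (l x) => [|y s] //.
    apply: leq_trans (hTg _) _; rewrite leq_mul2l; apply/orP; right.
    apply: leq_exp_base; rewrite !code_size_pair code_size_cons /=; lia.
  apply: poly_bounded_mul (poly_bounded_const _) _; apply: poly_bounded_exp; apply: poly_bounded_add (poly_bounded_const _).
  exact: poly_bounded_add (poly_bounded_sz) sl.
exists (dup_code ++ cl ++ case_code RA cf
  ([:: Push RA true] ++ swap_code ++ [:: Push RA true] ++ cg)),
  (fun x => 20 + 20 * code_size x + (Tl x + (10 + 9 * (code_size (l x) + code_size x) + (Tf x + Tg' x)))).
  have c n := @poly_bounded_const _ dA n.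
  by do ![apply: poly_bounded_add | apply: poly_bounded_mul | exact: c | exact: poly_bounded_sz | assumption].
move=> x rest.
apply: within_cat (within_dup _ _) _.
apply: within_cat (hl _ _) _; rewrite /Tg'.
case: (l x) => [|y s].
- apply: (@within_leq _ _ (Tf x).+2); first lia.
  by apply: within_case_false; [reflexivity | apply: hf].
- apply: (@within_leq _ _ (1 + ((6 + 9 * (code_size (y, s) + code_size x)) + (1 + Tg (x, (y, s))))).+1).
    by rewrite code_size_pair code_size_cons /=; lia.
  apply: within_case_true; first reflexivity.
  apply: within_cat (within_push_code _ _) _.
  have sw : within swap_code (value_store (code (y, s) ++ code x ++ rest))
      (6 + 9 * (code_size (y, s) + code_size x)) (value_store (code x ++ code (y, s) ++ rest)).
    exact: within_swap.
  rewrite code_pair /= in sw.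
  apply: within_cat sw _.
  apply: within_cat (within_push_code _ _) _.
  by have := hg (x, (y, s)) rest; rewrite !code_pair /= -!catA /= -!catA; apply.
Qed.

(** A hook, rebound later to the closure rules proved in between. *)
Ltac polytime_extra := fail.
Ltac solve_polytime := cbv beta; lazymatch goal with
  | |- polytime (fun x => x) => exact: polytime_id
  | |- polytime id => exact: polytime_id
  | |- polytime (fun x => (@?f x, @?g x)) => refine (polytime_pair (f := f) (g := g) _ _); solve_polytime
  | |- polytime (fun x => (@?f x).1) => refine (polytime_fst (f := f) _); solve_polytime
  | |- polytime (fun x => (@?f x).2) => refine (polytime_snd (f := f) _); solve_polytime
  | |- polytime fst => refine (polytime_fst (f := fun x => x) _); solve_polytime
  | |- polytime snd => refine (polytime_snd (f := fun x => x) _); solve_polytime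
  | |- polytime (fun x => @?f x :: @?g x) => refine (polytime_cons (f := f) (g := g) _ _); solve_polytime
  | |- polytime (fun x => (@?f x).+1) => refine (polytime_succ (f := f) _); solve_polytime
  | |- polytime _ => first [assumption | exact: polytime_const | polytime_extra | apply: polytime_if; solve_polytime]
  end.

(** * Folds with bounded accumulators *)

Definition fold_step A B C (g : A -> C -> B -> C) (p : seq B * (C * A)) :
    seq B * (C * A) :=
  if p.1 is y :: s then (s, (g p.2.2 p.2.1 y, p.2.2)) else p.

Lemma polytime_fold_step A B C {dA : data A} {dB : data B} {dC : data C}
    (g : A -> C -> B -> C) :
  polytime (fun p : (A * C) * B => g p.1.1 p.1.2 p.2) -> polytime (fold_step g).
Proof.
move=> hg; apply: (@polytime_list_case _ _ _ _ _ _ fst id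
  (fun p y s => (s, (g p.2.2 p.2.1 y, p.2.2)))).
- solve_polytime.
- solve_polytime.
apply: polytime_pair; first solve_polytime.
apply: polytime_pair; last solve_polytime.
apply: (polytime_comp (f := fun p => g p.1.1 p.1.2 p.2)
  (g := fun q : (seq B * (C * A)) * (B * seq B) => ((q.1.2.2, q.1.2.1), q.2.1))) => //.
solve_polytime.
Qed.

Definition fold_code (body : seq instr) : seq instr :=
  pop_code ++ while_code RA
    ([:: Push RA true] ++ [:: Push RA true] ++ body ++ pop_code).

(* Popping the tag of the pair [(l, (acc, x))] exposes the first bit of [l], which
   tells whether to go on; when [l] is empty, what remains is [(acc, x)]. *)
Lemma polytime_foldl A B C {dA : data A} {dB : data B} {dC : data C}
    (l : A -> seq B) (z : A -> C) (g : A -> C -> B -> C) (F : A -> nat) :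
  polytime l -> polytime z -> polytime (fun p : (A * C) * B => g p.1.1 p.1.2 p.2) ->
  poly_bounded F -> (forall x k, code_size (foldl (g x) (z x) (take k (l x))) <= F x) ->
  polytime (fun x => foldl (g x) (z x) (l x)).
Proof.
move=> hl hz hg hF leF; have sl := polytime_sz hl.
have [body [Tb [c [d hTb]] hb]] := polytime_fold_step hg.
(* Bounds the time of one round, whose argument consists of a suffix of [l x], an accumulator
   bounded by [F x], and [x], with two pair tags. *)
pose (K := fun x : A => c * (code_size (l x) + F x + code_size x + 2) ^ d).
have hK : poly_bounded K.
  have k n := @poly_bounded_const _ dA n.
  by do ![apply: poly_bounded_add | apply: poly_bounded_mul | apply: poly_bounded_exp | exact: k
         | exact: poly_bounded_sz | assumption].
have loop x L acc rest : code_size L <= code_size (l x) ->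
    (forall k, code_size (foldl (g x) acc (take k L)) <= F x) ->
    within (while_code RA
              ([:: Push RA true] ++ [:: Push RA true] ++ body ++ pop_code))
      (value_store (code L ++ code (acc, x) ++ rest))
      (1 + size L * (K x + 5))
      (value_store (code (foldl (g x) acc L, x) ++ rest)).
  elim: L acc => [|y L IH] acc le_L le_acc.
    exact: (@within_while_false RA).
  have {}IH := IH (g x acc y) _ (fun k => le_acc k.+1).
  have le_K : Tb (y :: L, (acc, x)) <= K x.
    apply: leq_trans (hTb _) _; rewrite leq_mul2l; apply/orP; right.
    apply: leq_exp_base; have := le_acc 0; rewrite /= !code_size_pair /=; lia.
  (* The 5 stands for the two pushes, the pop after the body, and the [Pop] and [Rewind] of the
     loop. *)
  apply: (@within_leq _ _ ((1 + size L * (K x + 5)) + (1 + (1 + (K x + 1))).+2)).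
    by rewrite /=; lia.
  apply: (within_while_true (l := code y ++ code L ++ code (acc, x) ++ rest)) (IH _); last first.
    by move: le_L; rewrite code_size_cons; lia.
  apply: within_cat (within_push_code _ _) _.
  apply: within_cat (within_push_code _ _) _.
  have := hb (y :: L, (acc, x)) rest; rewrite [fold_step _ _]/= => hb'.
  rewrite [code (y :: L, _)]code_pair code_cons [code (L, _)]code_pair /= -!catA in hb'.
  apply: within_cat (within_leq le_K hb') _.
  exact: within_pop_code.
  by rewrite code_cons /= -catA.
pose start x := (l x, (z x, x)).
have hstart : polytime start by apply: polytime_pair => //; apply: polytime_pair => //; solve_polytime.
have stop : polytime (fun x => (foldl (g x) (z x) (l x), x)).
  move: hstart => [cs [Ts hTs hs]].
  exists (cs ++ fold_code body),
    (fun x => Ts x + (1 + (1 + code_size (l x) * (K x + 5)) + 1)).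
    have k n := @poly_bounded_const _ dA n.
    by do ![assumption | apply: poly_bounded_add | apply: poly_bounded_mul | exact: k | exact: poly_bounded_sz].
  move=> x rest; apply: within_cat (hs x rest) _.
  apply: (@within_leq _ _ (1 + (1 + size (l x) * (K x + 5)))).
    have le_l : size (l x) <= code_size (l x) by exact: size_leq_sz.
    have : size (l x) * (K x + 5) <= code_size (l x) * (K x + 5) by rewrite leq_mul2r le_l orbT.
    by lia.
  rewrite /start [code (l x, _)]code_pair [(_ :: _) ++ rest]cat_cons -catA.
  exact: within_cat (within_pop_code _ _) (loop _ _ _ _ (leqnn _) (leF x)).
exact: (polytime_fst stop).
Qed.

Lemma polytime_app2 X A B C {dX : data X} {dA : data A} {dB : data B} {dC : data C}
    (f : A -> B -> C) (a : X -> A) (b : X -> B) :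
  polytime (fun p : A * B => f p.1 p.2) -> polytime a -> polytime b -> polytime (fun x => f (a x) (b x)).
Proof. by move=> hf ha hb; apply: polytime_comp hf (polytime_pair ha hb). Qed.

Lemma poly_bounded_size_mul A B {dA : data A} {dB : data B} (l : A -> seq B) (F : A -> nat) :
  polytime l -> poly_bounded F -> poly_bounded (fun x => size (l x) * F x).
Proof.
move=> hl hF; apply: poly_bounded_leq (poly_bounded_mul (polytime_sz hl) hF) => x.
by rewrite leq_mul2r size_leq_sz orbT.
Qed.

(* [F x] bounds the growth of the accumulator in one step. *)
Lemma polytime_foldl_grow A B C {dA : data A} {dB : data B} {dC : data C}
    (l : A -> seq B) (z : A -> C) (g : A -> C -> B -> C) (F : A -> nat) :
  polytime l -> polytime z -> polytime (fun p : (A * C) * B => g p.1.1 p.1.2 p.2) ->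
  poly_bounded F ->
  (forall x acc y, code_size y <= code_size (l x) -> code_size (g x acc y) <= code_size acc + F x) ->
  polytime (fun x => foldl (g x) (z x) (l x)).
Proof.
move=> hl hz hg hF leF.
apply: (@polytime_foldl _ _ _ _ _ _ _ _ _ (fun x => code_size (z x) + size (l x) * F x)) => //.
  by apply: poly_bounded_add; [apply: polytime_sz | apply: poly_bounded_size_mul].
move=> x k; have bound L acc : code_size L <= code_size (l x) ->
    code_size (foldl (g x) acc L) <= code_size acc + size L * F x.
  elim: L acc => [|y L IH] acc; first by rewrite addn0.
  rewrite code_size_cons => le_L; apply: leq_trans (IH _ _) _; first by lia.
  by rewrite /= mulSn addnA leq_add2r; apply: leF; lia.
apply: leq_trans (bound _ _ (code_size_take _ _)) _.
by rewrite leq_add2l leq_mul2r size_take_min geq_minr orbT.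
Qed.

Lemma polytime_foldl_bool A B {dA : data A} {dB : data B}
    (l : A -> seq B) (z : A -> bool) (g : A -> bool -> B -> bool) :
  polytime l -> polytime z -> polytime (fun p : (A * bool) * B => g p.1.1 p.1.2 p.2) ->
  polytime (fun x => foldl (g x) (z x) (l x)).
Proof.
move=> hl hz hg; apply: (polytime_foldl (F := fun=> 3)) => // [|x k].
  exact: poly_bounded_const.
exact: code_size_bool.
Qed.

(** * List operations in polynomial time *)

Section Lists.

Context {A B C : Type} {dA : data A} {dB : data B} {dC : data C}.

Lemma polytime_revmap (l : A -> seq B) (f : A -> B -> C) :
  polytime l -> polytime (fun p : A * B => f p.1 p.2) ->
  polytime (fun x => rev (map (f x) (l x))).
Proof.
move=> hl hf.
have {}hf' := polytime_sz hf.
apply: (@polytime_ext _ _ _ _ (fun x => foldl (fun s y => f x y :: s) [::] (l x))).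
  move=> x; rewrite /rev.
  by elim: (l x) [::] => //= y s IH acc; rewrite IH.
case: hf' => c [d le_f].
apply: (polytime_foldl_grow (F := fun x => c * (code_size x + code_size (l x) + 1) ^ d + 1)) => //.
- exact: polytime_const.
- apply: polytime_cons; last by solve_polytime.
  by apply: (polytime_app2 hf); solve_polytime.
- apply: poly_bounded_add (poly_bounded_const _); apply: poly_bounded_mul (poly_bounded_const _) _; apply: poly_bounded_exp.
  by apply: poly_bounded_add (poly_bounded_const _); apply: poly_bounded_add poly_bounded_sz _; apply: polytime_sz.
move=> x acc y le_y; rewrite code_size_cons.
have le1 : code_size (f x y) <= c * (code_size x + code_size (l x) + 1) ^ d.
  apply: leq_trans (le_f (x, y)) _; rewrite leq_mul2l; apply/orP; right.
  by apply: leq_exp_base; rewrite code_size_pair /=; lia.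
lia.
Qed.

Lemma foldl_cons (acc l : seq B) :
  foldl (fun s y => y :: s) acc l = catrev l acc.
Proof. by elim: l acc => //= y s IH acc; rewrite IH. Qed.

Lemma polytime_catrev (l1 l2 : A -> seq B) :
  polytime l1 -> polytime l2 -> polytime (fun x => catrev (l1 x) (l2 x)).
Proof.
move=> h1 h2; apply: (polytime_ext (fun x => foldl_cons (l2 x) (l1 x))).
apply: (polytime_foldl_grow (F := fun x => code_size (l1 x) + 1)) => //; first solve_polytime.
  by apply: poly_bounded_add (poly_bounded_const _); apply: polytime_sz.
by move=> x acc y le_y; rewrite code_size_cons; lia.
Qed.

Lemma polytime_rev (l : A -> seq B) : polytime l -> polytime (fun x => rev (l x)).
Proof. by move=> hl; apply: polytime_catrev => //; solve_polytime. Qed.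

Lemma polytime_size (l : A -> seq B) : polytime l -> polytime (fun x => size (l x)).
Proof.
move=> hl.
apply: (@polytime_ext _ _ _ _ (fun x => foldl (fun n _ => n.+1) 0 (l x))).
  by move=> x; rewrite -[RHS]add0n; elim: (l x) 0 => [|y s IH] n; rewrite ?addn0 //= IH addSnnS.
apply: (polytime_foldl_grow (F := fun x => 2)) => //; [solve_polytime|solve_polytime|exact: poly_bounded_const|].
by move=> x n y _; rewrite !code_size_nat; lia.
Qed.

Lemma polytime_all (l : A -> seq B) (p : A -> B -> bool) :
  polytime l -> polytime (fun q : A * B => p q.1 q.2) -> polytime (fun x => all (p x) (l x)).
Proof.
move=> hl hp.
apply: (@polytime_ext _ _ _ _ (fun x => foldl (fun b y => if b then p x y else false) true (l x))).
  move=> x; elim: (l x) => //= y s IH; by case: (p x y) => //=; elim: s {IH}.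
apply: polytime_foldl_bool => //; first solve_polytime.
apply: polytime_if; [solve_polytime| |solve_polytime].
by apply: (polytime_app2 hp); solve_polytime.
Qed.

Lemma polytime_filter (l : A -> seq B) (p : A -> B -> bool) :
  polytime l -> polytime (fun q : A * B => p q.1 q.2) -> polytime (fun x => filter (p x) (l x)).
Proof.
move=> hl hp.
have h : polytime (fun x => rev (filter (p x) (l x))).
  apply: (@polytime_ext _ _ _ _ (fun x => foldl (fun s y => if p x y then y :: s else s) [::] (l x))).
    move=> x; rewrite /rev; elim: (l x) [::] => //= y s IH acc.
    by case: (p x y); rewrite IH.
  apply: (polytime_foldl_grow (F := fun x => code_size (l x) + 1)) => //; [solve_polytime | | |].
  - apply: polytime_if; [|solve_polytime|solve_polytime].
    by apply: (polytime_app2 hp); solve_polytime.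
  - by apply: poly_bounded_add (poly_bounded_const _); apply: polytime_sz.
  - by move=> x acc y le_y; case: (p x y); rewrite ?code_size_cons; lia.
by apply: (polytime_ext (fun x => revK (filter (p x) (l x)))); apply: polytime_rev.
Qed.

End Lists.

Lemma polytime_cat A B {dA : data A} {dB : data B} (l1 l2 : A -> seq B) :
  polytime l1 -> polytime l2 -> polytime (fun x => l1 x ++ l2 x).
Proof.
move=> h1 h2; apply: (@polytime_ext _ _ _ _ (fun x => catrev (rev (l1 x)) (l2 x))).
  by move=> x; rewrite catrevE revK.
by apply: polytime_catrev => //; apply: polytime_rev.
Qed.

Lemma polytime_map A B C {dA : data A} {dB : data B} {dC : data C}
    (l : A -> seq B) (f : A -> B -> C) :
  polytime l -> polytime (fun p : A * B => f p.1 p.2) -> polytime (fun x => map (f x) (l x)).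
Proof.
move=> hl hf; apply: (@polytime_ext _ _ _ _ (fun x => rev (rev (map (f x) (l x))))).
  by move=> x; rewrite revK.
by apply: polytime_rev; apply: polytime_revmap.
Qed.

Lemma polytime_flatten A B {dA : data A} {dB : data B} (l : A -> seq (seq B)) :
  polytime l -> polytime (fun x => flatten (l x)).
Proof.
move=> hl.
apply: (@polytime_ext _ _ _ _ (fun x => foldl (fun acc s => acc ++ s) [::] (l x))).
  move=> x; rewrite -[RHS]cat0s; elim: (l x) [::] => [|y s IH] acc /=; first by rewrite cats0.
  by rewrite IH catA.
apply: (polytime_foldl_grow (F := fun x => code_size (l x))) => //; [solve_polytime | | |].
- by apply: polytime_cat; solve_polytime.
- exact: polytime_sz.
- move=> x acc y le_y.
  have e : (code_size (acc ++ y)).+1 = code_size acc + code_size y by exact: code_size_cat.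
  by lia.
Qed.

(** * Iteration and unary arithmetic *)

Lemma polytime_nseq A {dA : data A} (n : A -> nat) : polytime n -> polytime (fun x => nseq (n x) tt).
(* Both values have the same tree, so recursion on numbers becomes a fold over copies of [tt]. *)
Proof. by apply: polytime_recode => x; elim: (n x) => // m /(congr1 (Node Leaf)). Qed.

Lemma iter_foldl (C : Type) (f : C -> C) n z :
  iter n f z = foldl (fun s _ => f s) z (nseq n tt).
Proof. by elim: n z => //= n IH z; rewrite -IH -iterSr. Qed.

Lemma take_nseq_min (T : Type) i j (x : T) : take i (nseq j x) = nseq (minn i j) x.
Proof.
by case: leqP => h; [rewrite take_nseq | rewrite take_oversize // size_nseq ltnW].
Qed.

Lemma polytime_iter A C {dA : data A} {dC : data C}
    (n : A -> nat) (z : A -> C) (g : A -> C -> C) (F : A -> nat) :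
  polytime n -> polytime z -> polytime (fun p : A * C => g p.1 p.2) -> poly_bounded F ->
  (forall x k, code_size (iter k (g x) (z x)) <= F x) ->
  polytime (fun x => iter (n x) (g x) (z x)).
Proof.
move=> hn hz hg hF leF.
apply: (@polytime_ext _ _ _ _ (fun x => foldl (fun s _ => g x s) (z x) (nseq (n x) tt))).
  by move=> x; rewrite iter_foldl.
apply: (polytime_foldl (g := fun x s _ => g x s) (F := F)) => //; first exact: polytime_nseq.
  by apply: (polytime_app2 hg); solve_polytime.
by move=> x k; rewrite take_nseq_min /= -iter_foldl.
Qed.

Lemma polytime_iter_grow A C {dA : data A} {dC : data C}
    (n : A -> nat) (z : A -> C) (g : A -> C -> C) (F : A -> nat) :
  polytime n -> polytime z -> polytime (fun p : A * C => g p.1 p.2) -> poly_bounded F ->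
  (forall x s, code_size (g x s) <= code_size s + F x) ->
  polytime (fun x => iter (n x) (g x) (z x)).
Proof.
move=> hn hz hg hF leF.
apply: (@polytime_ext _ _ _ _ (fun x => foldl (fun s _ => g x s) (z x) (nseq (n x) tt))).
  by move=> x; rewrite iter_foldl.
apply: (polytime_foldl_grow (g := fun x s _ => g x s) (F := F)) => //; first exact: polytime_nseq.
by apply: (polytime_app2 hg); solve_polytime.
Qed.

Lemma polytime_behead A B {dA : data A} {dB : data B} (l : A -> seq B) :
  polytime l -> polytime (fun x => behead (l x)).
Proof.
move=> hl; apply: (@polytime_ext _ _ _ _ (fun x => if l x is _ :: s then s else [::])).
  by move=> x; case: (l x).
by apply: (polytime_list_case (g := fun _ _ s => s)) => //; solve_polytime.
Qed.

Lemma polytime_head A B {dA : data A} {dB : data B} (y0 : A -> B) (l : A -> seq B) :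
  polytime y0 -> polytime l -> polytime (fun x => head (y0 x) (l x)).
Proof.
move=> hy hl; apply: (@polytime_ext _ _ _ _ (fun x => if l x is y :: _ then y else y0 x)).
  by move=> x; case: (l x).
by apply: (polytime_list_case (g := fun _ y _ => y)) => //; solve_polytime.
Qed.

Lemma polytime_nth A B {dA : data A} {dB : data B} (y0 : A -> B) (l : A -> seq B)
    (n : A -> nat) :
  polytime y0 -> polytime l -> polytime n -> polytime (fun x => nth (y0 x) (l x) (n x)).
Proof.
move=> hy hl hn.
apply: (@polytime_ext _ _ _ _ (fun x => head (y0 x) (iter (n x) (@behead B) (l x)))).
  by move=> x; elim: (n x) (l x) => [|m IH] [|y s] //; rewrite iterSr IH //= nth_nil.
apply: polytime_head => //; apply: (polytime_iter_grow (F := fun=> 0)) => //.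
- by apply: polytime_behead; solve_polytime.
- exact: poly_bounded_const.
- by move=> x s; rewrite addn0; apply: code_size_behead.
Qed.

Lemma polytime_pred A {dA : data A} (n : A -> nat) : polytime n -> polytime (fun x => (n x).-1).
Proof.
move=> hn; apply: (polytime_recode (f := fun x => behead (nseq (n x) tt))).
  move=> x; case: (n x) => // m; rewrite [behead _]/= [m.+1.-1]/=.
  by elim: m => // m /(congr1 (Node Leaf)).
by apply: polytime_behead; apply: polytime_nseq.
Qed.

Lemma polytime_addn A {dA : data A} (m n : A -> nat) : polytime m -> polytime n -> polytime (fun x => m x + n x).
Proof.
move=> hm hn; apply: (@polytime_ext _ _ _ _ (fun x => iter (m x) succn (n x))).
  by move=> x; rewrite iter_succn addnC.
apply: (polytime_iter_grow (F := fun=> 2)) => //; [solve_polytime | exact: poly_bounded_const |].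
by move=> x s; rewrite !code_size_nat; lia.
Qed.

Lemma polytime_subn A {dA : data A} (m n : A -> nat) : polytime m -> polytime n -> polytime (fun x => m x - n x).
Proof.
move=> hm hn; apply: (@polytime_ext _ _ _ _ (fun x => iter (n x) predn (m x))).
  by move=> x; rewrite iter_predn.
apply: (polytime_iter_grow (F := fun=> 0)) => //; [|exact: poly_bounded_const|].
  by apply: polytime_pred; solve_polytime.
by move=> x s; rewrite !code_size_nat; lia.
Qed.

Lemma polytime_muln A {dA : data A} (m n : A -> nat) : polytime m -> polytime n -> polytime (fun x => m x * n x).
Proof.
move=> hm hn; apply: (@polytime_ext _ _ _ _ (fun x => iter (m x) (addn (n x)) 0)).
  by move=> x; rewrite iter_addn_0 mulnC.
apply: (polytime_iter_grow (F := fun x => code_size (n x))) => //; [solve_polytime | | exact: polytime_sz |].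
  apply: polytime_addn; last by solve_polytime.
  by apply: (polytime_comp hn); solve_polytime.
by move=> x s; rewrite !code_size_nat; lia.
Qed.

Lemma polytime_eq0 A {dA : data A} (n : A -> nat) : polytime n -> polytime (fun x => n x == 0).
Proof.
move=> hn; apply: (@polytime_ext _ _ _ _ (fun x => if nseq (n x) tt is _ :: _ then false else true)).
  by move=> x; case: (n x).
apply: (polytime_list_case (g := fun _ _ _ => false)); [exact: polytime_nseq | solve_polytime | solve_polytime].
Qed.

Lemma polytime_eqn A {dA : data A} (m n : A -> nat) : polytime m -> polytime n -> polytime (fun x => m x == n x).
Proof.
move=> hm hn; apply: (@polytime_ext _ _ _ _ (fun x => (m x - n x) + (n x - m x) == 0)).
  by move=> x; lia.
by apply: polytime_eq0; apply: polytime_addn; apply: polytime_subn.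
Qed.

(** The list built so far supplies the next number as its own length. *)
Lemma polytime_iota A {dA : data A} (n : A -> nat) : polytime n -> polytime (fun x => iota 0 (n x)).
Proof.
move=> hn.
have h k : iter k (fun s => size s :: s) [::] = rev (iota 0 k).
  elim: k => // k IH; rewrite iterS IH size_rev size_iota -addn1 iotaD rev_cat.
  by rewrite add0n.
apply: (@polytime_ext _ _ _ _ (fun x => rev (foldl (fun s _ => size s :: s) [::] (nseq (n x) tt)))).
  by move=> x; rewrite -iter_foldl h revK.
apply: polytime_rev.
apply: (polytime_foldl (g := fun _ s _ => size s :: s)
  (F := fun x => 1 + size (nseq (n x) tt) * (code_size (n x) + 1))).
- exact: polytime_nseq.
- solve_polytime.
- by apply: polytime_cons; [apply: polytime_size|]; solve_polytime.
- apply: poly_bounded_add (poly_bounded_const _) _; apply: poly_bounded_size_mul; first exact: polytime_nseq.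
  by apply: poly_bounded_add (poly_bounded_const _); apply: polytime_sz.
move=> x k; rewrite take_nseq_min /= -iter_foldl size_nseq code_size_nat.
have le_k : minn k (n x) <= n x by rewrite geq_minr.
apply: (@leq_trans (1 + minn k (n x) * ((n x).*2.+1 + 1))); last first.
  by rewrite leq_add2l leq_mul2r le_k orbT.
elim: (minn _ _) le_k => [|j IH] lt_j; first by rewrite code_size_nil.
have e : size (iter j (fun s => size s :: s) [::]) = j by rewrite h size_rev size_iota.
rewrite iterS code_size_cons e code_size_nat; have := IH (ltnW lt_j); rewrite mulSn.
by lia.
Qed.

Lemma polytime_eqb A {dA : data A} (b1 b2 : A -> bool) :
  polytime b1 -> polytime b2 -> polytime (fun x => b1 x == b2 x).
Proof.
move=> h1 h2; apply: (@polytime_ext _ _ _ _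
  (fun x => if b1 x then b2 x else if b2 x then false else true)).
  by move=> x; case: (b1 x); case: (b2 x).
by do 2!apply: polytime_if => //; solve_polytime.
Qed.

Lemma polytime_addb A {dA : data A} (b1 b2 : A -> bool) :
  polytime b1 -> polytime b2 -> polytime (fun x => b1 x (+) b2 x).
Proof.
move=> h1 h2; apply: (@polytime_ext _ _ _ _ (fun x => if b1 x then ~~ b2 x else b2 x)).
  by move=> x; case: (b1 x); case: (b2 x).
by apply: polytime_if => //; solve_polytime.
Qed.

Lemma polytime_andb A {dA : data A} (b1 b2 : A -> bool) :
  polytime b1 -> polytime b2 -> polytime (fun x => b1 x && b2 x).
Proof. by move=> h1 h2; apply: polytime_if => //; solve_polytime. Qed.

Ltac polytime_bits := fail.
Ltac polytime_instance := fail.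
Ltac polytime_extra ::= lazymatch goal with
  | |- polytime (fun x => [seq @?f x y | y <- @?l x]) =>
      refine (polytime_map (l := l) (f := f) _ _); solve_polytime
  | |- polytime (fun x => [seq y <- @?l x | @?f x y]) =>
      refine (polytime_filter (l := l) (p := f) _ _); solve_polytime
  | |- polytime (fun x => all (@?f x) (@?l x)) =>
      refine (polytime_all (l := l) (p := f) _ _); solve_polytime
  | |- polytime (fun x => size (@?l x)) => refine (polytime_size (l := l) _); solve_polytime
  | |- polytime (fun x => @?l x ++ @?l' x) =>
      refine (polytime_cat (l1 := l) (l2 := l') _ _); solve_polytime
  | |- polytime (fun x => flatten (@?l x)) => refine (polytime_flatten (l := l) _); solve_polytime
  | |- polytime (fun x => behead (@?l x)) => refine (polytime_behead (l := l) _); solve_polytime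
  | |- polytime (fun x => head (@?y x) (@?l x)) =>
      refine (polytime_head (y0 := y) (l := l) _ _); solve_polytime
  | |- polytime (fun x => nth (@?y x) (@?l x) (@?n x)) =>
      refine (polytime_nth (y0 := y) (l := l) (n := n) _ _ _); solve_polytime
  | |- polytime (fun x => @?m x + @?n x) =>
      refine (polytime_addn (m := m) (n := n) _ _); solve_polytime
  | |- polytime (fun x => @?m x * @?n x) =>
      refine (polytime_muln (m := m) (n := n) _ _); solve_polytime
  | |- polytime (fun x => @?m x == @?n x) =>
      first [ refine (polytime_eqn (m := m) (n := n) _ _)
            | refine (polytime_eqb (b1 := m) (b2 := n) _ _)]; solve_polytime
  | |- polytime (fun x => @?m x (+) @?n x) =>
      refine (polytime_addb (b1 := m) (b2 := n) _ _); solve_polytime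
  | |- polytime (fun x => @?m x && @?n x) =>
      refine (polytime_andb (b1 := m) (b2 := n) _ _); solve_polytime
  | |- polytime (fun x => iota 0 (@?n x)) => refine (polytime_iota (n := n) _); solve_polytime
  | |- _ => first [polytime_bits | polytime_instance]
  end.

(** * The decision procedure *)

(* An instance is a word together with the size of the universe it announces. *)
Local Notation inst := (seq bool * nat)%type.
Local Notation triple := (nat * (nat * nat))%type.
Local Notation bits := (bool * (bool * bool))%type.
Local Notation row := (seq bool).

(* The last entry of a row is the right-hand side of its equation. *)
Definition xor_row (r p : row) : row :=
  [seq nth false r i (+) nth false p i | i <- iota 0 (size r)].

(* Eliminates the variable of the first column.  The pivot row is kept: it
   becomes the equation 0 = 0. *)
Definition eliminate (S : seq row) : seq row :=
  [seq behead (if head false r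
               then xor_row r (head [::] [seq p <- S | head false p]) else r)
  | r <- S].

(** After [n] rounds only right-hand sides remain, and a remaining [true] is the equation 0 = 1. *)
Definition consistent (n : nat) (S : seq row) : bool :=
  all (fun r => ~~ head false r) (iter n eliminate S).

(** * Polynomial time of Gaussian elimination *)

Lemma polytime_xor_row A {dA : data A} (r p : A -> row) :
  polytime r -> polytime p -> polytime (fun x => xor_row (r x) (p x)).
Proof.
apply: polytime_app2; rewrite /xor_row.
refine (polytime_map (f := fun (q : row * row) i => nth false q.1 i (+) nth false q.2 i) _ _).
  solve_polytime.
by apply: polytime_addb; solve_polytime.
Qed.

Lemma polytime_eliminate A {dA : data A} (S : A -> seq row) :
  polytime S -> polytime (fun x => eliminate (S x)).
Proof.
apply: polytime_comp; rewrite /eliminate.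
refine (polytime_map (f := fun (S : seq row) r =>  behead (if head false r
               then xor_row r (head [::] [seq p <- S | head false p]) else r)) _ _).
  solve_polytime.
apply: polytime_behead; apply: polytime_if; [solve_polytime| |solve_polytime].
by apply: polytime_xor_row; solve_polytime.
Qed.

Lemma size_xor_row r p : size (xor_row r p) = size r.
Proof. by rewrite size_map size_iota. Qed.

Lemma code_size_row (r : row) : code_size r <= 4 * size r + 1.
Proof.
elim: r => // b r IH; rewrite code_size_cons.
have := code_size_bool b.
by rewrite /=; lia.
Qed.

Lemma code_size_rows m (S : seq row) : all (fun r => size r <= m) S ->
  code_size S <= size S * (4 * m + 2) + 1.
Proof.
elim: S => // r S IH /andP[le_r /IH {}IH]; rewrite code_size_cons.
have := code_size_row r; rewrite [size (_ :: _)]/= [(size S).+1 * _]mulSn. lia.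
Qed.

Lemma size_iter_eliminate k S : size (iter k eliminate S) = size S.
Proof. by elim: k => //= k IH; rewrite size_map. Qed.

Lemma eliminate_bound m S : all (fun r => size r <= m) S ->
  all (fun r => size r <= m) (eliminate S).
Proof.
move=> /allP h; rewrite all_map; apply/allP => r /h le_r /=.
rewrite size_behead; apply: leq_trans (leq_pred _) _.
by case: ifP => // _; rewrite size_xor_row.
Qed.

Lemma rows_bound (S : seq row) : all (fun r => size r <= code_size S) S.
Proof.
elim: S => // r S IH; rewrite code_size_cons /=; apply/andP; split.
  have le_r : size r <= code_size r by exact: size_leq_sz.
  by lia.
by apply: sub_all IH => r' /=; lia.
Qed.

(** Elimination keeps the number of rows and never lengthens one, so all intermediate systems obey
    one quadratic bound. *)
Lemma polytime_consistent A {dA : data A} (n : A -> nat) (S : A -> seq row) :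
  polytime n -> polytime S -> polytime (fun x => consistent (n x) (S x)).
Proof.
move=> hn hS; apply: polytime_all; last by solve_polytime.
apply: (polytime_iter (g := fun _ S => eliminate S)
  (F := fun x => code_size (S x) * (4 * code_size (S x) + 2) + 1)) => //.
- by apply: polytime_eliminate; solve_polytime.
- have c k := @poly_bounded_const _ dA k.
  by do ![apply: poly_bounded_add | apply: poly_bounded_mul | exact: c | exact: (polytime_sz hS)].
move=> x k; apply: leq_trans (@code_size_rows (code_size (S x)) _ _) _.
  by elim: k => [|k IH] /=; [apply: rows_bound | apply: eliminate_bound].
rewrite size_iter_eliminate leq_add2r leq_mul2r; apply/orP; right.
exact: size_leq_sz.
Qed.

(* The length of the longest prefix of [true]s. *)
Definition universe_size (w : seq bool) : nat :=
  size [seq i <- iota 0 (size w) | all (fun j => nth false w j) (iota 0 i.+1)].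

(** * Reading an instance and setting up its equations *)

Section Instance.

Variable E : inst.
Local Notation n := E.2.

(** The [n.+1] skips the unary size and the [false] that ends it. *)
Definition entry (k : nat) : bool := nth false E.1 (n.+1 + k).

(* The offsets follow the order of [symbols (pair_vocabulary multipede_vocabulary)]. *)
Definition in_first (i : nat) : bool := entry i.
Definition is_segment (i : nat) : bool := entry (n + i).
Definition foot_of (i j : nat) : bool := entry (3 * n + (i * n + j)).
Definition is_hyperedge (i j k : nat) : bool :=
  entry (3 * n + n * n + (i * (n * n) + (j * n + k))).
Definition is_positive (i j k : nat) : bool :=
  entry (3 * n + n * n + n * (n * n) + (i * (n * n) + (j * n + k))).
Definition is_le (i j : nat) : bool :=
  entry (3 * n + n * n + 2 * (n * (n * n)) + (i * n + j)).
Definition is_shoe (i : nat) : bool :=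
  entry (3 * n + 2 * (n * n) + 2 * (n * (n * n)) + i).

Definition segments (b : bool) : seq nat :=
  [seq i <- iota 0 n | is_segment i && (in_first i == b)].

Definition rank (i : nat) : nat := size [seq j <- iota 0 n | is_le j i].

(** An order isomorphism preserves ranks, so a segment can only be sent to its match. *)
Definition matches : seq (nat * nat) :=
  [seq p <- flatten [seq [seq (i, j) | j <- segments false] | i <- segments true]
  | rank p.1 == rank p.2].

Definition feet (i : nat) : seq nat := [seq j <- iota 0 n | foot_of j i].
(** The two feet are named after their order in the encoding, an arbitrary choice. *)
Definition foot_at (i : nat) (b : bool) : nat := nth 0 (feet i) (if b then 1 else 0).

Definition cube : seq (bool * (bool * bool)) :=
  [seq (a, bc) | a <- [:: false; true],
     bc <- [seq (b, c) | b <- [:: false; true], c <- [:: false; true]]].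

(** Relations of all arities are read at a triple. The shoe is tested at the first entry only, which
    loses nothing because every matched segment comes first in some triple. *)
Definition profile (s : nat * (nat * nat)) (y : bool * (bool * bool)) :
    bool * (bool * bool) :=
  (is_positive (foot_at s.1 y.1) (foot_at s.2.1 y.2.1) (foot_at s.2.2 y.2.2),
   (is_shoe (foot_at s.1 y.1), is_hyperedge s.1 s.2.1 s.2.2)).

Definition add3 (x y : bool * (bool * bool)) : bool * (bool * bool) :=
  (x.1 (+) y.1, (x.2.1 (+) y.2.1, x.2.2 (+) y.2.2)).

Definition eq3 (x y : bool * (bool * bool)) : bool :=
  (x.1 == y.1) && ((x.2.1 == y.2.1) && (x.2.2 == y.2.2)).

Definition dot3 (x y : bool * (bool * bool)) : bool :=
  (x.1 && y.1) (+) ((x.2.1 && y.2.1) (+) (x.2.2 && y.2.2)).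

(* [x] exchanges feet so that the named feet of the segments [s] are carried to
   those of [t] compatibly with all relations. *)
Definition fitting (s t : nat * (nat * nat)) (x : bool * (bool * bool)) : bool :=
  all (fun y => eq3 (profile s y) (profile t (add3 y x))) cube.

(** If nothing fits, every equation is implied vacuously, 0 = 1 among them. *)
Definition implied (s t : nat * (nat * nat)) (e : bool * (bool * bool) * bool) :
    bool :=
  all (fun x => if fitting s t x then dot3 e.1 x == e.2 else true) cube.

(** There is one unknown for each element of the universe. The product with the indicator triple
    adds up the coefficients of a segment that occurs several times in [s]. *)
Definition equation_row (s : nat * (nat * nat)) (e : bool * (bool * bool) * bool) :
    row :=
  [seq dot3 e.1 (i == s.1, (i == s.2.1, i == s.2.2)) | i <- iota 0 n] ++ [:: e.2].

Definition equations : seq (bool * (bool * bool) * bool) :=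
  [seq (a, b) | a <- cube, b <- [:: false; true]].

Definition local_rows (m : (nat * nat) * ((nat * nat) * (nat * nat))) : seq row :=
  let s := (m.1.1, (m.2.1.1, m.2.2.1)) in
  let t := (m.1.2, (m.2.1.2, m.2.2.2)) in
  [seq equation_row s e | e <- [seq e <- equations | implied s t e]].

Definition system : seq row :=
  flatten [seq flatten [seq flatten [seq local_rows (m1, (m2, m3))
    | m3 <- matches] | m2 <- matches] | m1 <- matches].

(** Segments whose rank is not attained on the other side impose no equation; the comparison of
    sizes rules them out. *)
Definition decide_instance : bool :=
  (size (segments true) == size (segments false)) && consistent n system.

End Instance.

Definition decide (w : seq bool) : bool := decide_instance (w, universe_size w).

(** * Polynomial time of the decision procedure *)

Lemma polytime_app3 X A B C D {dX : data X} {dA : data A} {dB : data B} {dC : data C}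
    {dD : data D} (f : A -> B -> C -> D) (a : X -> A) (b : X -> B) (c : X -> C) :
  polytime (fun p : A * (B * C) => f p.1 p.2.1 p.2.2) -> polytime a -> polytime b -> polytime c ->
  polytime (fun x => f (a x) (b x) (c x)).
Proof. by move=> hf ha hb hc; apply: polytime_comp hf (polytime_pair ha (polytime_pair hb hc)). Qed.

Lemma polytime_app4 X A B C D F {dX : data X} {dA : data A} {dB : data B} {dC : data C}
    {dD : data D} {dF : data F} (f : A -> B -> C -> D -> F)
    (a : X -> A) (b : X -> B) (c : X -> C) (d : X -> D) :
  polytime (fun p : A * (B * (C * D)) => f p.1 p.2.1 p.2.2.1 p.2.2.2) ->
  polytime a -> polytime b -> polytime c -> polytime d -> polytime (fun x => f (a x) (b x) (c x) (d x)).
Proof.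
by move=> hf ha hb hc hd; apply: polytime_comp hf (polytime_pair ha (polytime_pair hb (polytime_pair hc hd))).
Qed.

Lemma polytime_eq3 : polytime (fun p : bits * bits => eq3 p.1 p.2).
Proof. rewrite /eq3; solve_polytime. Qed.

Lemma polytime_add3 : polytime (fun p : bits * bits => add3 p.1 p.2).
Proof. rewrite /add3; solve_polytime. Qed.

Lemma polytime_dot3 : polytime (fun p : bits * bits => dot3 p.1 p.2).
Proof. rewrite /dot3; solve_polytime. Qed.

Ltac polytime_bits ::= lazymatch goal with
  | |- polytime (fun x => eq3 _ _) => apply: (polytime_app2 polytime_eq3); solve_polytime
  | |- polytime (fun x => add3 _ _) => apply: (polytime_app2 polytime_add3); solve_polytime
  | |- polytime (fun x => dot3 _ _) => apply: (polytime_app2 polytime_dot3); solve_polytime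
  end.

Lemma polytime_entry : polytime (fun p : inst * nat => entry p.1 p.2).
Proof. rewrite /entry; solve_polytime. Qed.

Ltac polytime_instance ::= lazymatch goal with
  | |- polytime (fun x => entry _ _) => apply: (polytime_app2 polytime_entry); solve_polytime
  end.

Lemma polytime_in_first : polytime (fun p : inst * nat => in_first p.1 p.2).
Proof. rewrite /in_first; solve_polytime. Qed.

Lemma polytime_is_segment : polytime (fun p : inst * nat => is_segment p.1 p.2).
Proof. rewrite /is_segment; solve_polytime. Qed.

Lemma polytime_foot_of : polytime (fun p : inst * (nat * nat) => foot_of p.1 p.2.1 p.2.2).
Proof. rewrite /foot_of; solve_polytime. Qed.

Lemma polytime_is_hyperedge :
  polytime (fun p : inst * triple => is_hyperedge p.1 p.2.1 p.2.2.1 p.2.2.2).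
Proof. rewrite /is_hyperedge; solve_polytime. Qed.

Lemma polytime_is_positive :
  polytime (fun p : inst * triple => is_positive p.1 p.2.1 p.2.2.1 p.2.2.2).
Proof. rewrite /is_positive; solve_polytime. Qed.

Lemma polytime_is_le : polytime (fun p : inst * (nat * nat) => is_le p.1 p.2.1 p.2.2).
Proof. rewrite /is_le; solve_polytime. Qed.

Lemma polytime_is_shoe : polytime (fun p : inst * nat => is_shoe p.1 p.2).
Proof. rewrite /is_shoe; solve_polytime. Qed.

Ltac polytime_instance ::= lazymatch goal with
  | |- polytime (fun x => in_first _ _) => apply: (polytime_app2 polytime_in_first); solve_polytime
  | |- polytime (fun x => is_segment _ _) => apply: (polytime_app2 polytime_is_segment); solve_polytime
  | |- polytime (fun x => foot_of _ _ _) => apply: (polytime_app3 polytime_foot_of); solve_polytime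
  | |- polytime (fun x => is_hyperedge _ _ _ _) => apply: (polytime_app4 polytime_is_hyperedge); solve_polytime
  | |- polytime (fun x => is_positive _ _ _ _) => apply: (polytime_app4 polytime_is_positive); solve_polytime
  | |- polytime (fun x => is_le _ _ _) => apply: (polytime_app3 polytime_is_le); solve_polytime
  | |- polytime (fun x => is_shoe _ _) => apply: (polytime_app2 polytime_is_shoe); solve_polytime
  end.

Lemma polytime_segments : polytime (fun p : inst * bool => segments p.1 p.2).
Proof. rewrite /segments; solve_polytime. Qed.

Lemma polytime_rank : polytime (fun p : inst * nat => rank p.1 p.2).
Proof. rewrite /rank; solve_polytime. Qed.

Lemma polytime_foot_at : polytime (fun p : inst * (nat * bool) => foot_at p.1 p.2.1 p.2.2).
Proof. rewrite /foot_at /feet; solve_polytime. Qed.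

Ltac polytime_instance ::= lazymatch goal with
  | |- polytime (fun x => is_hyperedge _ _ _ _) => apply: (polytime_app4 polytime_is_hyperedge); solve_polytime
  | |- polytime (fun x => is_positive _ _ _ _) => apply: (polytime_app4 polytime_is_positive); solve_polytime
  | |- polytime (fun x => is_shoe _ _) => apply: (polytime_app2 polytime_is_shoe); solve_polytime
  | |- polytime (fun x => segments _ _) => apply: (polytime_app2 polytime_segments); solve_polytime
  | |- polytime (fun x => rank _ _) => apply: (polytime_app2 polytime_rank); solve_polytime
  | |- polytime (fun x => foot_at _ _ _) => apply: (polytime_app3 polytime_foot_at); solve_polytime
  end.

Lemma polytime_matches : polytime matches.
Proof. rewrite /matches; solve_polytime. Qed.

Lemma polytime_profile : polytime (fun p : inst * (triple * bits) => profile p.1 p.2.1 p.2.2).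
Proof. rewrite /profile; solve_polytime. Qed.

Ltac polytime_instance ::= lazymatch goal with
  | |- polytime (fun x => profile _ _ _) => apply: (polytime_app3 polytime_profile); solve_polytime
  end.

Lemma polytime_fitting :
  polytime (fun p : inst * (triple * (triple * bits)) => fitting p.1 p.2.1 p.2.2.1 p.2.2.2).
Proof. rewrite /fitting; solve_polytime. Qed.

Ltac polytime_instance ::= lazymatch goal with
  | |- polytime (fun x => fitting _ _ _ _) => apply: (polytime_app4 polytime_fitting); solve_polytime
  end.

Lemma polytime_implied :
  polytime (fun p : inst * (triple * (triple * (bits * bool))) =>
        implied p.1 p.2.1 p.2.2.1 p.2.2.2).
Proof. rewrite /implied; solve_polytime. Qed.

Lemma polytime_equation_row :
  polytime (fun p : inst * (triple * (bits * bool)) => equation_row p.1 p.2.1 p.2.2).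
Proof. rewrite /equation_row; solve_polytime. Qed.

Ltac polytime_instance ::= lazymatch goal with
  | |- polytime (fun x => implied _ _ _ _) => apply: (polytime_app4 polytime_implied); solve_polytime
  | |- polytime (fun x => equation_row _ _ _) => apply: (polytime_app3 polytime_equation_row); solve_polytime
  end.

Lemma polytime_local_rows :
  polytime (fun p : inst * ((nat * nat) * ((nat * nat) * (nat * nat))) => local_rows p.1 p.2).
Proof. rewrite /local_rows; solve_polytime. Qed.

Ltac polytime_instance ::= lazymatch goal with
  | |- polytime (fun x => local_rows _ _) => apply: (polytime_app2 polytime_local_rows); solve_polytime
  | |- polytime (fun x => segments _ _) => apply: (polytime_app2 polytime_segments); solve_polytime
  | |- polytime (fun x => matches _) => apply: (polytime_comp polytime_matches); solve_polytime
  end.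

Lemma polytime_system : polytime system.
Proof. rewrite /system; solve_polytime. Qed.

Lemma polytime_universe_size : polytime universe_size.
Proof. rewrite /universe_size; solve_polytime. Qed.

Lemma polytime_decide : polytime decide.
Proof.
apply: (polytime_comp (f := decide_instance) (g := fun w => (w, universe_size w))).
  rewrite /decide_instance; apply: polytime_if; [solve_polytime| |solve_polytime].
  by apply: polytime_consistent; [solve_polytime | exact: polytime_system].
apply: polytime_pair; [solve_polytime | exact: polytime_universe_size].
Qed.

(** * From polynomial-time functions to Turing machines *)

Definition quote_code : seq instr :=
  pour RA RB ++ [:: Push RA false] ++
  loop_code RB [:: Push RA false; Push RA true]
    [:: Push RA false; Push RA false; Push RA true; Push RA true].

(** The input tape holds a bare word, whereas programs expect its code as a list. The code is built
    from the last bit on, so the word is first reversed, and the bits for each element are pushed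
    backwards. *)
Lemma within_quote (w : seq bool) :
  within quote_code (value_store w) (12 * code_size w) (value_store (code w)).
Proof.
have build l v : within (loop_code RB [:: Push RA false; Push RA true]
    [:: Push RA false; Push RA false; Push RA true; Push RA true])
    (Store (code v) l [::] [::]) (1 + 6 * size l) (value_store (code (catrev l v))).
  elim: l v => [|b l IH] v; first by exists 1 => //; apply: runs_loop_nil.
  have [t le_t h] := IH (b :: v).
  exists (t + (if b then 4 else 2).+2); first by rewrite /=; case: b {IH h}; lia.
  apply: (runs_loop_cons (b := b) (l := l)) h => //.
  case: b {IH}.
    apply: (runs_cat (c1 := [:: _]) (t1 := 1) (t2 := 3) (runs_push _ _ _)).
    apply: (runs_cat (c1 := [:: _]) (t1 := 1) (t2 := 2) (runs_push _ _ _)).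
    exact: (runs_cat (c1 := [:: _]) (t1 := 1) (t2 := 1) (runs_push _ _ _) (runs_push _ _ _)).
  exact: (runs_cat (c1 := [:: _]) (t1 := 1) (t2 := 1) (runs_push _ _ _) (runs_push _ _ _)).
have pour_w := @within_pour RA RB (value_store w) isT.
rewrite /= cats0 in pour_w.
have := within_cat (pour_w) (within_cat (within_push RA false (Store [::] (rev w) [::] [::])) (build (rev w) [::])).
rewrite -/(rev (rev w)) revK; apply: within_leq.
have le_w : size w <= code_size w by exact: size_leq_sz.
have w_gt0 : 0 < code_size w by exact: code_size_gt0.
by rewrite size_rev /=; lia.
Qed.

Lemma code_size_word (w : seq bool) : code_size w <= 5 * (size w).+1.
Proof. by have := code_size_row w; lia. Qed.

Lemma polytime_machine (D : seq bool -> bool) : polytime D ->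
  exists2 M : machine, polynomial_time M & forall w, accepts M w <-> D w.
Proof.
move=> [c [T [a [d le_T]] h]].
have [q within_q] : exists q, forall w,
    within q (value_store w) (12 * code_size w) (value_store (code w)).
  by exists quote_code; apply: within_quote.
(* The first bit of the code of a boolean is the boolean itself, so one pop gives the verdict. *)
pose C := q ++ c ++ [:: Pop RA 0 0 1; Halt false; Halt true].
have [|halts decides] := @instr_machine_decides C D (fun w => 12 * code_size w + T w + 1).
  move=> w.
  have [t1 le1 h1] := within_q w.
  have := h w [::]; rewrite !cats0 => -[t2 le2 h2].
  exists (1 + (t1 + t2)); first by lia.
  have := runs_cat h1 h2 [::] [:: Pop RA 0 0 1; Halt false; Halt true].
  rewrite -catA -/C /= => runs.
  rewrite iterD runs add0n /= (fetch_at (C := C) (i := Pop RA 0 0 1)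
    (C1 := q ++ c) (C2 := [:: Halt false; Halt true])) //; last first.
    by rewrite /C -catA.
  case: (D w) => /=; do 2!eexists; split; try reflexivity.
    rewrite addn1; apply: (fetch_at (C1 := q ++ c ++ [:: Pop RA 0 0 1; Halt false]) (C2 := [::])).
      by rewrite /C -!catA.
    by rewrite !size_cat /= !addnS addn0.
  rewrite addn0; apply: (fetch_at (C1 := q ++ c ++ [:: Pop RA 0 0 1]) (C2 := [:: Halt true])).
    by rewrite /C -!catA.
  by rewrite !size_cat /= !addnS addn0.
exists (instr_machine C) => //.
(* Doubling [12 * code_size w + T w + 1] gives the first factor; the powers of 5 and 2 come from
   [code_size_word] and from (m + 1)^e <= (2m)^e + 2^e. The exponent [d.+1] also absorbs the linear
   term. *)
pose K := (24 + 2 * a + 2) * 5 ^ d.+1 * 2 ^ d.+1.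
exists K, d.+1 => w.
have [t le_t ht] := halts w; exists t => //; apply: leq_trans le_t _.
have s_gt0 : 0 < code_size w by exact: code_size_gt0.
have le1 : code_size w <= code_size w ^ d.+1 by rewrite expnS leq_pmulr // expn_gt0 s_gt0.
have le2 : code_size w ^ d <= code_size w ^ d.+1 by rewrite leq_pexp2l.
have le3 : a * code_size w ^ d <= a * code_size w ^ d.+1 by rewrite leq_mul2l le2 orbT.
have le4 : 0 < code_size w ^ d.+1 by rewrite expn_gt0 s_gt0.
apply: (@leq_trans ((24 + 2 * a + 2) * code_size w ^ d.+1)).
  have := le_T w; rewrite mulnDl mulnDl -mulnA; lia.
apply: (@leq_trans ((24 + 2 * a + 2) * (5 ^ d.+1 * (size w).+1 ^ d.+1))).
  rewrite leq_mul2l -expnMn; apply/orP; right.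
  by apply: leq_exp_base; apply: code_size_word.
have le5 : (size w).+1 ^ d.+1 <= 2 ^ d.+1 * size w ^ d.+1 + 2 ^ d.+1.
  case: (size w) => [|m]; first by rewrite exp1n exp0n // muln0 add0n expn_gt0.
  by apply: leq_trans (leq_addr _ _); rewrite -expnMn; apply: leq_exp_base; lia.
have -> : K * size w ^ d.+1 + K =
    (24 + 2 * a + 2) * (5 ^ d.+1 * (2 ^ d.+1 * size w ^ d.+1 + 2 ^ d.+1)).
  by rewrite /K !mulnDr !mulnA.
by rewrite leq_mul2l leq_mul2l le5 !orbT.
Qed.

Lemma decide_machine :
  exists2 M : machine, polynomial_time M & forall w, accepts M w <-> decide w.
Proof. exact: polytime_machine polytime_decide. Qed.

(** * Correctness of the decision procedure *)

Definition value (r x : seq bool) : bool :=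
  \big[addb/false]_(i < size x) (nth false r i && nth false x i).

Lemma value_cons r b x : value r (b :: x) = (head false r && b) (+) value (behead r) x.
Proof.
rewrite /value /= big_ord_recl /= nth0; congr addb.
by apply: eq_bigr => i _; rewrite nth_behead.
Qed.

Lemma value_xor_row r p x : size p <= size r ->
  value (xor_row r p) x = value r x (+) value p x.
Proof.
move=> le_pr; rewrite /value -big_split /=; apply: eq_bigr => i _.
rewrite -andb_addl; congr (_ && _).
case: (ltnP i (size r)) => [lt_i|le_i].
  by rewrite (nth_map 0) ?size_iota // nth_iota.
by rewrite !nth_default // ?size_xor_row // (leq_trans le_pr).
Qed.

(** The [true] appended to [x] multiplies the right-hand side, so a row is satisfied when its value
    is [false]. One round of elimination is undone by back substitution into the pivot row. *)
Lemma consistentP n S : all (fun r => size r == n.+1) S ->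
  reflect (exists2 x, size x = n & forall r, r \in S -> value r (rcons x true) = false)
          (consistent n S).
Proof.
elim: n S => [|n IH] S sizeS.
  apply: (iffP allP) => [h|[x /size0nil -> h] r /h].
    exists [::] => // r /h; rewrite /= value_cons /value big_ord0 addbF andbT.
    by case: head.
  by rewrite /= value_cons /value big_ord0 addbF andbT => ->.
rewrite /consistent iterSr -/(consistent n (eliminate S)).
set p := head [::] [seq p <- S | head false p].
have pS r : r \in S -> head false r -> p \in S /\ head false p.
  move=> rS hr; have : p \in [seq p <- S | head false p].
    have : r \in [seq p <- S | head false p] by rewrite mem_filter hr.
    by rewrite /p; case: filter => // q l _; rewrite inE eqxx.
  by rewrite mem_filter => /andP[].
have size_of_row r : r \in S -> size r = n.+2 by move=> /(allP sizeS)/eqP.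
have sizeE : all (fun r => size r == n.+1) (eliminate S).
  rewrite all_map; apply/allP => r rS /=.
  by rewrite size_behead; case: ifP => _; rewrite ?size_xor_row (size_of_row r rS).
apply: (iffP (IH _ sizeE)) => [[x sx h]|[[|b x] // [sx] h]].
(* The first unknown is solved from the pivot row. Without a pivot, [p] is empty and no row has a
   leading coefficient. *)
- exists (value (behead p) (rcons x true) :: x); first by rewrite /= sx.
  move=> r rS; rewrite /= value_cons.
  have /h : behead (if head false r then xor_row r p else r) \in eliminate S.
    exact: (map_f (fun r => behead (if head false r then xor_row r p else r)) rS).
  case: ifP => hr; last by move=> ->.
  have [pS' hp] := pS r rS hr.
  (* A first coordinate [false] hides the leading column, so the identity for full rows becomes one
     for their tails. *)
  have := value_xor_row (false :: rcons x true) (eq_leq (etrans (size_of_row _ pS') (esym (size_of_row _ rS)))).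
  by rewrite !value_cons !andbF /= => ->; case: (value _ _); case: (value _ _).
- exists x => // r' /mapP[r rS ->].
  have := h r rS; rewrite /= value_cons; case: ifP => hr; last by [].
  have [pS' hp] := pS r rS hr; rewrite -/p => hrv.
  have := value_xor_row (false :: rcons x true) (eq_leq (etrans (size_of_row _ pS') (esym (size_of_row _ rS)))).
  rewrite !value_cons !andbF /= => ->.
  by have := h p pS'; rewrite /= value_cons hp; move: hrv; case: (value _ _); case: (value _ _); case: (b).
Qed.

(** * Affine subsets of F_2^3 *)

Lemma mem_cube x : x \in cube.
Proof. by case: x => [[] [[] []]]. Qed.

Lemma allcubeP (p : bits -> bool) : reflect (forall x, p x) (all p cube).
Proof.
by apply: (iffP allP) => h x; [apply: h; apply: mem_cube | move=> _; apply: h].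
Qed.

Lemma mem_equations e : e \in equations.
Proof. by case: e => [[[] [[] []]] []]. Qed.

Lemma eq3P x y : reflect (x = y) (eq3 x y).
Proof.
case: x y => [a [b c]] [a' [b' c']]; rewrite /eq3 /=.
apply: (iffP and3P) => [[/eqP-> /eqP-> /eqP->]|[-> -> ->]] //.
Qed.

(* The subset of [cube] whose characteristic vector is [c]. *)
Definition subset_of (c : seq bool) (x : bits) : bool := nth false c (index x cube).

(** In characteristic 2, closure under x + y + z characterizes the empty set and the affine
    subspaces. *)
Definition sum_closed (C : bits -> bool) : bool :=
  all (fun x => all (fun y => all (fun z =>
    [&& C x, C y & C z] ==> C (add3 x (add3 y z))) cube) cube) cube.

Definition separated (C : bits -> bool) : bool :=
  all (fun x => ~~ C x ==>
    has (fun e => all (fun y => C y ==> (dot3 e.1 y == e.2)) cube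
                  && (dot3 e.1 x != e.2)) equations) cube.

(** An exhaustive check of the 256 subsets, given by their characteristic vectors. *)
Lemma sum_closed_separated (c1 c2 c3 c4 c5 c6 c7 c8 : bool) :
  let C := subset_of [:: c1; c2; c3; c4; c5; c6; c7; c8] in
  sum_closed C ==> separated C.
Proof.
by move: c1 c2 c3 c4 c5 c6 c7 c8; do 8![case]; vm_compute.
Qed.

(** This lets a constraint closed under triple sums, possibly empty, be replaced by the equations it
    implies. *)
Lemma affine_subset (C : bits -> bool) :
  (forall x y z, C x -> C y -> C z -> C (add3 x (add3 y z))) ->
  forall x, (forall e, (forall y, C y -> dot3 e.1 y = e.2) -> dot3 e.1 x = e.2) -> C x.
Proof.
move=> closedC x hx; apply/negPn/negP => nCx.
have := sum_closed_separated (C (false, (false, false))) (C (false, (false, true)))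
 (C (false, (true, false))) (C (false, (true, true))) (C (true, (false, false)))
 (C (true, (false, true))) (C (true, (true, false))) (C (true, (true, true))).
(* The eight values above are those of [C] in the order of [cube]. *)
rewrite -[X in subset_of X]/[seq C z | z <- cube] /=.
have CE y : subset_of [seq C z | z <- cube] y = C y.
  by rewrite /subset_of (nth_map y) ?index_mem ?mem_cube // nth_index ?mem_cube.
move: (subset_of _) CE => C' CE /implyP sep.
have /sep/allP : sum_closed C'.
  apply/allcubeP => a; apply/allcubeP => b; apply/allcubeP => d.
  by rewrite !CE; apply/implyP => /and3P[]; apply: closedC.
move=> /(_ x (mem_cube x)); rewrite CE nCx => /hasP[e _ /andP[/allcubeP he /eqP[]]].
by apply: hx => y Cy; have := he y; rewrite CE Cy => /eqP.
Qed.

Lemma add3A x y z : add3 x (add3 y z) = add3 (add3 x y) z.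
Proof. by rewrite /add3 /= !addbA. Qed.

Lemma add3C x y : add3 x y = add3 y x.
Proof. by rewrite /add3 addbC (addbC x.2.1) (addbC x.2.2). Qed.

Lemma add3K x y : add3 (add3 x y) y = x.
Proof. by case: x => a [b c]; rewrite /add3 /= !addbK. Qed.

(** * Solutions of the system and fitting vectors *)

Section Instance.

Context (E : inst).

Lemma fittingP s t x :
  reflect (forall y, profile E s y = profile E t (add3 y x)) (fitting E s t x).
Proof. by apply: (iffP (allcubeP _)) => h y; apply/eq3P. Qed.

(** Go across by [x], back by [z] and across again by [y]: over F_2 each translation is its own
    inverse. *)
Lemma fitting_affine s t x y z :
  fitting E s t x -> fitting E s t y -> fitting E s t z ->
  fitting E s t (add3 x (add3 y z)).
Proof.
move=> /fittingP hx /fittingP hy /fittingP hz; apply/fittingP => u.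
rewrite hx -[add3 u x](add3K _ z) -hz hy; congr (profile E t _).
by rewrite !add3A -!(add3A (add3 u x)) (add3C z).
Qed.

Lemma value_equation_row s e x : size x = E.2 ->
  s.1 < E.2 -> s.2.1 < E.2 -> s.2.2 < E.2 ->
  value (equation_row E s e) (rcons x true) =
  dot3 e.1 (nth false x s.1, (nth false x s.2.1, nth false x s.2.2)) (+) e.2.
Proof.
move=> sx lt1 lt2 lt3.
have sr : size [seq dot3 e.1 (i == s.1, (i == s.2.1, i == s.2.2)) | i <- iota 0 E.2] = E.2.
  by rewrite size_map size_iota.
rewrite /value /equation_row size_rcons big_ord_recr /= nth_cat sr sx ltnn subnn.
rewrite nth_rcons sx ltnn eqxx andbT /=; congr addb.
(* Each of the three positions is summed on its own, which covers coinciding segments. *)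
have pick a k : k < E.2 -> \big[addb/false]_(i < E.2) (a && (i == k :> nat) && nth false x i)
    = a && nth false x k.
  move=> lt_k; rewrite (bigD1 (Ordinal lt_k)) //= eqxx andbT big1 ?addbF // => i ne.
  by rewrite -val_eqE /= in ne; rewrite (negPf ne) andbF.
rewrite /dot3 /= -!pick // -!big_split /=; apply: eq_bigr => i _.
rewrite nth_cat sr ltn_ord nth_rcons sx ltn_ord.
rewrite (nth_map 0) ?size_iota // nth_iota // add0n.
by rewrite /= !andb_addl.
Qed.

Lemma matches_lt m : m \in matches E -> m.1 < E.2.
Proof.
rewrite mem_filter => /andP[_ /allpairsP[[i j] [/= hi _ ->]]] /=.
by move: hi; rewrite mem_filter mem_iota add0n => /andP[_ /andP[]].
Qed.

Lemma mem_system r : reflect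
  (exists m1 m2 m3, [/\ m1 \in matches E, m2 \in matches E, m3 \in matches E &
    r \in local_rows E (m1, (m2, m3))]) (r \in system E).
Proof.
apply: (iffP flattenP) => [[l1 /mapP[m1 h1 ->]]|[m1 [m2 [m3 [h1 h2 h3 hr]]]]].
  move=> /flattenP[l2 /mapP[m2 h2 ->] /flattenP[l3 /mapP[m3 h3 ->] hr]].
  by exists m1, m2, m3.
exists (flatten [seq flatten [seq local_rows E (m1, (m2, m3))
    | m3 <- matches E] | m2 <- matches E]).
  exact: (map_f (fun m1 => flatten [seq flatten [seq local_rows E (m1, (m2, m3))
    | m3 <- matches E] | m2 <- matches E]) h1).
apply/flattenP; exists (flatten [seq local_rows E (m1, (m2, m3)) | m3 <- matches E]).
  exact: (map_f (fun m2 => flatten [seq local_rows E (m1, (m2, m3)) | m3 <- matches E]) h2).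
apply/flattenP; exists (local_rows E (m1, (m2, m3))) => //.
exact: (map_f (fun m3 => local_rows E (m1, (m2, m3))) h3).
Qed.

(** At each triple, a solution satisfies all the equations implied by the fitting vectors, hence
    fits by [affine_subset]. Conversely, fitting bits satisfy every row because only implied
    equations were kept. *)
Lemma decide_instanceP :
  decide_instance E <->
  size (segments E true) = size (segments E false) /\
  exists X : nat -> bool, forall m1 m2 m3,
    m1 \in matches E -> m2 \in matches E -> m3 \in matches E ->
    fitting E (m1.1, (m2.1, m3.1)) (m1.2, (m2.2, m3.2)) (X m1.1, (X m2.1, X m3.1)).
Proof.
have size_rows : all (fun r => size r == E.2.+1) (system E).
  apply/allP => r /mem_system[m1 [m2 [m3 [_ _ _ /mapP[e _ ->]]]]].
  by rewrite size_cat size_map size_iota addn1.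
split.
  move=> /andP[/eqP eq_size /(consistentP size_rows)[x sx hx]]; split=> //.
  exists (nth false x) => m1 m2 m3 h1 h2 h3.
  apply: (affine_subset (@fitting_affine _ _)) => e he.
  have /hx : equation_row E (m1.1, (m2.1, m3.1)) e \in system E.
    apply/mem_system; exists m1, m2, m3; split=> //.
    apply: map_f; rewrite mem_filter mem_equations andbT.
    by apply/allcubeP => y; case: ifP => // /he ->.
  rewrite (@value_equation_row (_, (_, _)) _ _ sx (matches_lt h1) (matches_lt h2) (matches_lt h3)).
  by case: (dot3 _ _); case: (e.2).
move=> [eq_size [X hX]]; apply/andP; split; first exact/eqP.
apply/(consistentP size_rows); exists (mkseq X E.2); first exact: size_mkseq.
move=> r /mem_system[m1 [m2 [m3 [h1 h2 h3 /mapP[e]]]]].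
rewrite mem_filter => /andP[/allcubeP he _] ->.
rewrite (@value_equation_row (_, (_, _)) _ _ (size_mkseq _ _) (matches_lt h1) (matches_lt h2) (matches_lt h3)).
rewrite /= !nth_mkseq ?(matches_lt h1) ?(matches_lt h2) ?(matches_lt h3) //.
by have := he (X m1.1, (X m2.1, X m3.1)); rewrite hX // => /eqP ->; rewrite addbb.
Qed.

End Instance.

(** * Encodings of pairs of multipedes *)

Lemma universe_size_unary n t : universe_size (nseq n true ++ false :: t) = n.
Proof.
rewrite /universe_size size_cat size_nseq iotaD filter_cat size_cat add0n.
rewrite (eq_in_filter (a2 := predT)); last first.
  move=> i; rewrite mem_iota add0n => /andP[_ lt_i]; apply: (introT allP) => j.
  rewrite mem_iota add0n => /andP[_ le_j]; rewrite nth_cat size_nseq nth_nseq.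
  by rewrite (leq_trans le_j lt_i).
rewrite filter_predT size_iota (eq_in_filter (a2 := pred0)) ?filter_pred0 ?addn0 //.
move=> i; rewrite mem_iota => /andP[le_i _]; apply: (introF allP) => /(_ n).
by rewrite mem_iota add0n ltnS le_i nth_cat size_nseq ltnn subnn => /(_ isT).
Qed.

(** * Positions in lexicographic truth tables *)

Lemma nth_allpairs (S T R : Type) (f : S -> T -> R) s t d x0 y0 i j :
  i < size s -> j < size t ->
  nth d [seq f x y | x <- s, y <- t] (i * size t + j) = f (nth x0 s i) (nth y0 t j).
Proof.
elim: s i => // x s IH [|i] /= lt_i lt_j.
  by rewrite mul0n add0n nth_cat size_map lt_j (nth_map y0).
rewrite nth_cat size_map mulSn -addnA ltnNge leq_addr /= addKn.
exact: IH.
Qed.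

Lemma size_lex_tuples (T : Type) (s : seq T) k : size (lex_tuples s k) = size s ^ k.
Proof. by elim: k => //= k IH; rewrite size_allpairs IH expnS. Qed.

(** The positions in [s] of the entries of [t], read as digits in base [size s]. *)
Fixpoint lex_index (T : eqType) (s t : seq T) : nat :=
  if t is u :: t' then index u s * size s ^ size t' + lex_index s t' else 0.

Lemma lex_index_lt (T : eqType) (s t : seq T) :
  {subset t <= s} -> lex_index s t < size s ^ size t.
Proof.
elim: t => //= u t IH sub_t.
have /IH lt_t : {subset t <= s} by move=> x xt; apply: sub_t; rewrite inE xt orbT.
have lt_u : index u s < size s by rewrite index_mem sub_t ?inE ?eqxx.
rewrite expnS; apply: (@leq_trans ((index u s).+1 * size s ^ size t)).
  by rewrite mulSn addnC ltn_add2r.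
by rewrite leq_mul2r lt_u orbT.
Qed.

Lemma nth_lex_tuples (T : eqType) (s : seq T) k (t t0 : k.-tuple T) :
  {subset t <= s} -> nth t0 (lex_tuples s k) (lex_index s t) = t.
Proof.
elim: k t t0 => [|k IH] t t0; first by rewrite [t]tuple0 [t0]tuple0.
case/tupleP: t => u t; case/tupleP: t0 => u0 t0 sub_t.
have sub_t' : {subset t <= s} by move=> x xt; apply: sub_t; rewrite inE xt orbT.
have lt_u : index u s < size s by rewrite index_mem sub_t ?inE ?eqxx.
have -> : lex_index s [tuple of u :: t] =
    index u s * size (lex_tuples s k) + lex_index s t.
  by rewrite /= size_tuple size_lex_tuples.
rewrite [lex_tuples _ _.+1]/= (nth_allpairs _ _ u0 t0) //.
  by rewrite IH // nth_index -?index_mem //; apply: val_inj.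
by rewrite size_lex_tuples -{2}(size_tuple t) lex_index_lt.
Qed.

Section Decoding.

Context (V : vocabulary) (A : structure V) (le : rel (univ A)).

Local Notation elements := (sort le (enum (univ A))).

Definition instance_of : seq bool * nat := (encode le, universe_size (encode le)).

Lemma mem_elements u : u \in elements.
Proof. by rewrite mem_sort mem_enum. Qed.

Lemma instance_size : instance_of.2 = size elements.
Proof. by rewrite /= universe_size_unary. Qed.

(** The tables of the preceding symbols have known sizes, whose sum is the offset of the table of
    [r]. *)
Lemma entry_table r1 r r2 (t : (arity r).-tuple (univ A)) :
  symbols V = r1 ++ r :: r2 ->
  entry instance_of (sumn [seq size elements ^ arity q | q <- r1] +
                     lex_index elements t) = holds t.
Proof.
move=> symE; rewrite /entry instance_size /= /encode symE.
rewrite nth_cat size_nseq addSnnS ltnNge leq_addr /= addKn /=.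
rewrite map_cat flatten_cat nth_cat.
have -> : size (flatten [seq [seq holds t | t <- lex_tuples elements (arity r)] | r <- r1])
    = sumn [seq size elements ^ arity q | q <- r1].
  rewrite size_flatten /shape -map_comp; congr sumn; apply: eq_map => q /=.
  by rewrite size_map size_lex_tuples.
rewrite ltnNge leq_addr /= addKn nth_cat size_map size_lex_tuples.
have sub_t : {subset t <= elements} by move=> x _; apply: mem_elements.
have lt_t := lex_index_lt sub_t; rewrite size_tuple in lt_t.
by rewrite lt_t (nth_map t) ?size_lex_tuples // nth_lex_tuples.
Qed.

End Decoding.

Section Pair.

Context (MN : shoed_multipede3 * shoed_multipede3).
Context (le : rel (univ (multipede_pair MN))).

Local Notation M := (MN.1).
Local Notation N := (MN.2).
Local Notation U := (univ (multipede_pair MN)).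
Local Notation elements := (sort le (enum U)).
Local Notation pos u := (index (u : U) elements).
Local Notation E := (instance_of le).
Local Notation rel_on r t :=
  (@pair_holds _ (multipede_structure M) (multipede_structure N) (Some r) t).

Lemma in_first_pos (u : U) : in_first E (pos u) = if u is inl _ then true else false.
Proof.
have := @entry_table _ _ le [::] None _ [tuple u] erefl.
by rewrite /in_first /= addn0 muln1.
Qed.

Lemma is_segment_pos (u : U) : is_segment E (pos u) = rel_on SegmentSort [tuple u].
Proof.
apply: etrans (@entry_table _ _ le [:: None] (Some SegmentSort) _ [tuple u] erefl).
rewrite /is_segment instance_size; congr entry => /=; lia.
Qed.

Lemma foot_of_pos (u v : U) : foot_of E (pos u) (pos v) = rel_on SegmOf [tuple u; v].
Proof.
apply: etrans (@entry_table _ _ le [:: None; Some SegmentSort; Some FootSort]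
  (Some SegmOf) _ [tuple u; v] erefl).
rewrite /foot_of instance_size; congr entry => /=; lia.
Qed.

Lemma is_hyperedge_pos (u v w : U) :
  is_hyperedge E (pos u) (pos v) (pos w) = rel_on Hyperedge [tuple u; v; w].
Proof.
apply: etrans (@entry_table _ _ le [:: None; Some SegmentSort; Some FootSort; Some SegmOf]
  (Some Hyperedge) _ [tuple u; v; w] erefl).
rewrite /is_hyperedge instance_size; congr entry => /=; rewrite !expnS !expn0; lia.
Qed.

Lemma is_positive_pos (u v w : U) :
  is_positive E (pos u) (pos v) (pos w) = rel_on Positive [tuple u; v; w].
Proof.
apply: etrans (@entry_table _ _ le [:: None; Some SegmentSort; Some FootSort; Some SegmOf;
  Some Hyperedge] (Some Positive) _ [tuple u; v; w] erefl).
rewrite /is_positive instance_size; congr entry => /=; rewrite !expnS !expn0; lia.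
Qed.

Lemma is_le_pos (u v : U) : is_le E (pos u) (pos v) = rel_on SegLe [tuple u; v].
Proof.
apply: etrans (@entry_table _ _ le [:: None; Some SegmentSort; Some FootSort; Some SegmOf;
  Some Hyperedge; Some Positive] (Some SegLe) _ [tuple u; v] erefl).
rewrite /is_le instance_size; congr entry => /=; rewrite !expnS !expn0; lia.
Qed.

Lemma is_shoe_pos (u : U) : is_shoe E (pos u) = rel_on Shoe [tuple u].
Proof.
apply: etrans (@entry_table _ _ le [:: None; Some SegmentSort; Some FootSort; Some SegmOf;
  Some Hyperedge; Some Positive; Some SegLe] (Some Shoe) _ [tuple u] erefl).
rewrite /is_shoe instance_size; congr entry => /=; rewrite !expnS !expn0; lia.
Qed.

End Pair.

Lemma cards3 (T : finType) (A : {set T}) : #|A| = 3 ->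
  exists a b c, A = [set a; b; c].
Proof.
rewrite cardE; case E: (enum A) => [|a [|b [|c [|]]]] // _.
exists a, b, c; apply/setP => x.
by rewrite -mem_enum E !inE orbA.
Qed.

(** * Ranks of segments *)

Definition seg_rank (M : multipede3) (s : segment M) : nat :=
  #|[set t | seg_le t s]|.

Section Rank.

Context (M : multipede3).
Implicit Types s t : segment M.

(** Initial segments of a linear order are nested, strictly for distinct elements, so their
    cardinals recover the order. *)
Lemma seg_leE s t : seg_le s t = (seg_rank s <= seg_rank t).
Proof.
have [refl anti trans total] := seg_le_linear M.
have mono (u v : segment M) : seg_le u v -> [set w | seg_le w u] \subset [set w | seg_le w v].
  move=> le_uv; apply/subsetP => w; rewrite !inE => le_wu; exact: trans le_wu le_uv.
apply/idP/idP => [/mono/subset_leq_card //|]; apply: contraTT => nle.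
have le_ts : seg_le t s by have := total s t; rewrite (negPf nle).
rewrite -ltnNge; apply: proper_card; apply/properP; split; first exact: mono.
by exists s; rewrite inE ?refl.
Qed.

Lemma seg_rank_inj : injective (@seg_rank M).
Proof.
have [_ anti _ _] := seg_le_linear M.
by move=> s t e; apply: anti; rewrite !seg_leE e leqnn.
Qed.

Lemma seg_rank_gt0 s : 0 < seg_rank s.
Proof.
have [refl _ _ _] := seg_le_linear M.
by apply/card_gt0P; exists s; rewrite inE refl.
Qed.

Lemma seg_rank_le s : seg_rank s <= #|segment M|.
Proof. exact: max_card. Qed.

End Rank.

(** Ranks, lowered by one, inject the segments of [N] into an ordinal of the same cardinality, hence
    exhaust it. *)
Lemma seg_rank_match (M N : multipede3) (s : segment M) :
  #|segment M| = #|segment N| -> exists t : segment N, seg_rank t = seg_rank s.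
Proof.
move=> eq_card.
have ltN (t : segment N) : (seg_rank t).-1 < #|segment N|.
  by rewrite prednK ?seg_rank_gt0 ?seg_rank_le.
have ltM : (seg_rank s).-1 < #|segment N|.
  by rewrite prednK ?seg_rank_gt0 // -eq_card seg_rank_le.
have inj : injective (fun t => Ordinal (ltN t)).
  move=> t t' /(congr1 val) /= /(congr1 succn).
  by rewrite !prednK ?seg_rank_gt0 //; apply: seg_rank_inj.
have [h _ hK] := inj_card_bij inj (eq_leq (card_ord _)).
exists (h (Ordinal ltM)); have /(congr1 val) /= := hK (Ordinal ltM).
by move=> /(congr1 succn); rewrite !prednK ?seg_rank_gt0.
Qed.

(** * Isomorphisms as exchanges of feet *)

Definition foot_naming (M : multipede2) (name : segment M -> bool -> foot M) : Prop :=
  [/\ forall s y, segm (name s y) = s, forall s, injective (name s)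
    & forall a, exists y, a = name (segm a) y].

Section Isomorphism.

Context (M N : shoed_multipede3).
Context (nameM : segment M -> bool -> foot M) (nameN : segment N -> bool -> foot N).
Context (namingM : foot_naming nameM) (namingN : foot_naming nameN).

Definition local_profile (X : shoed_multipede3) (name : segment X -> bool -> foot X)
    (s : segment X * (segment X * segment X)) (y : bits) : bits :=
  ([set name s.1 y.1; name s.2.1 y.2.1; name s.2.2 y.2.2] \in positives X,
   (name s.1 y.1 == shoe X, [set s.1; s.2.1; s.2.2] \in hyperedges X)).

(** Above the rank-preserving map of segments, a bijection of feet only chooses at each segment one
    of the two bijections between pairs of feet, that is, a bit. *)
Lemma isomorphicP : isomorphic M N <->
  #|segment M| = #|segment N| /\
  exists x : segment M -> bool,
    forall s1 s2 s3 t1 t2 t3,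
      seg_rank s1 = seg_rank t1 -> seg_rank s2 = seg_rank t2 ->
      seg_rank s3 = seg_rank t3 -> forall y,
      local_profile nameM (s1, (s2, s3)) y =
      local_profile nameN (t1, (t2, t3)) (add3 y (x s1, (x s2, x s3))).
Proof.
have [segmM injM allM] := namingM; have [segmN injN allN] := namingN.
split.
- move=> [f [g [[bij_f bij_g] fg [hypf posg] le_f shoeg]]].
  split; first exact: bij_eq_card bij_f.
  have inj_f := bij_inj bij_f; have inj_g := bij_inj bij_g.
  (* The image of the foot named [false] fixes the bit; injectivity sends the other foot to the
     other name. *)
  pose x s := g (nameM s false) == nameN (f s) true; exists x.
  have gE s y : g (nameM s y) = nameN (f s) (y (+) x s).
    have named z : exists y', g (nameM s z) = nameN (f s) y'.
      by have [y'] := allN (g (nameM s z)); rewrite fg segmM => e; exists y'.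
    have g0 : g (nameM s false) = nameN (f s) (x s).
      rewrite /x; case: eqP => // ne; have [[] //] := named false.
    case: y => //; have [y' e] := named true; rewrite e.
    have : y' != x s.
      by apply/eqP => ey; have := injM s true false (inj_g _ _ (etrans e (etrans (congr1 _ ey) (esym g0)))).
    by case: y' {e}; case: (x s).
  have rank_f s : seg_rank (f s) = seg_rank s.
    rewrite /seg_rank -(card_imset _ inj_f); apply: eq_card => t; rewrite inE.
    have [h fK hK] := bij_f; rewrite -[t]hK le_f (mem_imset _ _ inj_f) inE //.
  have match_f s t : seg_rank s = seg_rank t -> t = f s.
    by rewrite -rank_f => /seg_rank_inj ->.
  move=> s1 s2 s3 t1 t2 t3 /match_f -> /match_f -> /match_f -> y.
  rewrite /local_profile /= -!gE -hypf -posg !imsetU !imset_set1 -shoeg (inj_eq inj_g) //.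
- move=> [eq_card [x hx]].
  have [f rank_f] := fin_all_exists (fun s => @seg_rank_match M N s eq_card).
  have inj_f : injective f.
    by move=> s t e; apply: seg_rank_inj; rewrite -!rank_f e.
  have bij_f : bijective f by apply: inj_card_bij inj_f _; rewrite eq_card.
  have {}hx s1 s2 s3 := hx s1 s2 s3 _ _ _ (esym (rank_f s1)) (esym (rank_f s2)) (esym (rank_f s3)).
  have ex_g (a : foot M) : exists b, exists2 y, a = nameM (segm a) y &
      b = nameN (f (segm a)) (y (+) x (segm a)).
    by have [y e] := allM a; exists (nameN (f (segm a)) (y (+) x (segm a))), y.
  have [g gP] := fin_all_exists ex_g.
  have gE s y : g (nameM s y) = nameN (f s) (y (+) x s).
    by have [y' e ->] := gP (nameM s y); rewrite segmM in e *; rewrite (injM _ _ _ e).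
  have segm_g a : segm (g a) = f (segm a).
    by have [y _ ->] := gP a; rewrite segmN.
  have [f' fK f'K] := bij_f.
  have inj_g : injective g.
    move=> a a'; have [y ea eg] := gP a; have [y' ea' eg'] := gP a'.
    move=> e; have es : segm a = segm a' by apply: inj_f; rewrite -!segm_g e.
    move: e; rewrite eg eg' es => /injN /addIb ey.
    by rewrite ea ea' es ey.
  have surj_g b : exists a, g a = b.
    have [y e] := allN b; exists (nameM (f' (segm b)) (y (+) x (f' (segm b)))).
    by rewrite gE f'K addbK -e.
  have [g' g'K] := fin_all_exists surj_g.
  have bij_g : bijective g by exists g' => // a; apply: inj_g; rewrite g'K.
  exists f, g; split=> //.
  + split=> [H|P].
      (* Profiles only speak of triples; sets of any other size are excluded on both sides by
         cardinality. *)
      case: (#|H| =P 3) => [/cards3[s1 [s2 [s3 ->]]]|nH].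
        rewrite !imsetU !imset_set1.
        (* Hyperedges do not depend on the names of feet, so any bits serve. *)
        by have [] := hx s1 s2 s3 (false, (false, false)).
      transitivity false; last apply/esym.
        by apply/negP => /card_hyperedge; rewrite card_imset.
      by apply/negP => /card_hyperedge.
    case: (#|P| =P 3) => [/cards3[a1 [a2 [a3 ->]]]|nP].
      rewrite !imsetU !imset_set1.
      have [y1 e1] := allM a1; have [y2 e2] := allM a2; have [y3 e3] := allM a3.
      have [] := hx (segm a1) (segm a2) (segm a3) (y1, (y2, y3)).
      by rewrite /= -!gE -e1 -e2 -e3.
    transitivity false; last apply/esym.
      by apply/negP => /card_positive; rewrite card_imset.
    by apply/negP => /card_positive.
  + by move=> s t; rewrite !seg_leE !rank_f.
  + have [y e] := allM (shoe M); set s := segm _ in e.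
    (* The shoe is read off the constant triple at its segment. *)
    have [_] := hx s s s (y, (y, y)).
    by rewrite /= -!gE -e eqxx => /esym/eqP.
Qed.

End Isomorphism.

Lemma index_iota (T : eqType) (s : seq T) :
  uniq s -> [seq index u s | u <- s] = iota 0 (size s).
Proof.
case: s => // u0 s0 us; set s := u0 :: s0 in us *.
apply: (@eq_from_nth _ 0); rewrite size_map ?size_iota // => i lt_i.
by rewrite (nth_map u0) // nth_iota // index_uniq.
Qed.

(** * Relations of a disjoint union *)

Lemma map_inl_inr (S T : Type) (s : seq S) (t : seq T) :
  map inl s = map inr t -> size s = 0.
Proof. by case: s; case: t. Qed.

Section PairHolds.

Context (V : vocabulary) (A B : structure V).

(** A nullary relation of the disjoint union is the disjunction of both sides, hence the positive
    arity. *)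
Lemma pair_holds_left (r : symbol V) t (w : (arity r).-tuple (univ A)) :
  0 < arity r -> tval t = map inl w ->
  @pair_holds V A B (Some r) t = holds w.
Proof.
move=> gt0 et; apply/orP/idP => [[|]|hw].
- move=> /existsP[u /andP[hu /eqP e]]; suff <- : u = w by [].
  apply: val_inj; apply: (inj_map (f := @inl (univ A) (univ B))) => [x y []//|].
  by move: e => /(congr1 val) /= <-; rewrite et.
- move=> /existsP[u /andP[_ /eqP/(congr1 val)]]; rewrite /= et.
  by move=> /map_inl_inr; rewrite size_tuple => r0; rewrite r0 in gt0.
- left; apply/existsP; exists w; rewrite hw /=; apply/eqP; exact: val_inj.
Qed.

Lemma pair_holds_right (r : symbol V) t (w : (arity r).-tuple (univ B)) :
  0 < arity r -> tval t = map inr w ->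
  @pair_holds V A B (Some r) t = holds w.
Proof.
move=> gt0 et; apply/orP/idP => [[|]|hw].
- move=> /existsP[u /andP[_ /eqP/(congr1 val)]]; rewrite /= et => /esym.
  by move=> /map_inl_inr; rewrite size_tuple => r0; rewrite r0 in gt0.
- move=> /existsP[u /andP[hu /eqP e]]; suff <- : u = w by [].
  apply: val_inj; apply: (inj_map (f := @inr (univ A) (univ B))) => [x y []//|].
  by move: e => /(congr1 val) /= <-; rewrite et.
- right; apply/existsP; exists w; rewrite hw /=; apply/eqP; exact: val_inj.
Qed.

Lemma pair_holds_mixed (r : symbol V) t a b :
  inl a \in tval t -> inr b \in tval t -> @pair_holds V A B (Some r) t = false.
Proof.
move=> ha hb; apply/orP => -[] /existsP[u /andP[_ /eqP/(congr1 val)/= e]].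
  by move: hb; rewrite e => /mapP[].
by move: ha; rewrite e => /mapP[].
Qed.

End PairHolds.

Section PairMultipede.

Context (M N : shoed_multipede3).
Local Notation rel_on r t :=
  (@pair_holds _ (multipede_structure M) (multipede_structure N) (Some r) t).

Lemma pair_multipede_left r t w :
  tval t = map inl w -> rel_on r t = multipede_holds r w.
Proof.
move=> et.
have sw : size w == arity (v := multipede_vocabulary) r.
  by have := congr1 size et; rewrite size_map size_tuple => <-.
have gt0 : 0 < arity (v := multipede_vocabulary) r by case: (r).
exact: (pair_holds_left (A := multipede_structure M) (w := Tuple sw) gt0 et).
Qed.

Lemma pair_multipede_right r t w :
  tval t = map inr w -> rel_on r t = multipede_holds r w.
Proof.
move=> et.
have sw : size w == arity (v := multipede_vocabulary) r.
  by have := congr1 size et; rewrite size_map size_tuple => <-.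
have gt0 : 0 < arity (v := multipede_vocabulary) r by case: (r).
exact: (pair_holds_right (B := multipede_structure N) (w := Tuple sw) gt0 et).
Qed.

Lemma pair_multipede_mixed r t (a : segment M + foot M) (b : segment N + foot N) :
  inl a \in tval t -> inr b \in tval t -> rel_on r t = false.
Proof.
exact: (@pair_holds_mixed _ (multipede_structure M) (multipede_structure N) r t a b).
Qed.

End PairMultipede.

(** * Reading a pair of multipedes off its encoding *)

Section Pair.

Context (MN : shoed_multipede3 * shoed_multipede3).
Context (le : rel (univ (multipede_pair MN))).

Local Notation M := (MN.1).
Local Notation N := (MN.2).
Local Notation U := (univ (multipede_pair MN)).
Local Notation elements := (sort le (enum U)).
Local Notation pos u := (index (u : U) elements).
Local Notation E := (instance_of le).

(** A boolean index lets facts about both multipedes be stated once; [true] is the side marked by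
    the relation [None]. *)
Definition side (b : bool) : shoed_multipede3 := if b then M else N.

Definition seg_elt (b : bool) : segment (side b) -> U :=
  match b with true => fun s => inl (inl s) | false => fun s => inr (inl s) end.

Definition foot_elt (b : bool) : foot (side b) -> U :=
  match b with true => fun a => inl (inr a) | false => fun a => inr (inr a) end.

Arguments seg_elt : clear implicits.
Arguments foot_elt : clear implicits.

Lemma seg_elt_inj b : injective (seg_elt b).
Proof. by case: b => s t []. Qed.

Lemma foot_elt_inj b : injective (foot_elt b).
Proof. by case: b => s t []. Qed.

Lemma pos_inj : injective (fun u : U => pos u).
Proof.
move=> u v e.
by rewrite -(nth_index u (mem_elements le u)) e nth_index // mem_elements.
Qed.

Lemma is_positive_foot b (a1 a2 a3 : foot (side b)) :
  is_positive E (pos (foot_elt b a1)) (pos (foot_elt b a2)) (pos (foot_elt b a3))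
  = ([set a1; a2; a3] \in positives (side b)).
Proof.
rewrite is_positive_pos; case: b a1 a2 a3 => a1 a2 a3.
  by rewrite (@pair_multipede_left _ _ _ _ [:: inr a1; inr a2; inr a3]).
by rewrite (@pair_multipede_right _ _ _ _ [:: inr a1; inr a2; inr a3]).
Qed.

Lemma is_hyperedge_seg b (s1 s2 s3 : segment (side b)) :
  is_hyperedge E (pos (seg_elt b s1)) (pos (seg_elt b s2)) (pos (seg_elt b s3))
  = ([set s1; s2; s3] \in hyperedges (side b)).
Proof.
rewrite is_hyperedge_pos; case: b s1 s2 s3 => s1 s2 s3.
  by rewrite (@pair_multipede_left _ _ _ _ [:: inl s1; inl s2; inl s3]).
by rewrite (@pair_multipede_right _ _ _ _ [:: inl s1; inl s2; inl s3]).
Qed.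

Lemma is_shoe_foot b (a : foot (side b)) :
  is_shoe E (pos (foot_elt b a)) = (a == shoe (side b)).
Proof.
rewrite is_shoe_pos; case: b a => a.
  by rewrite (@pair_multipede_left _ _ _ _ [:: inr a]).
by rewrite (@pair_multipede_right _ _ _ _ [:: inr a]).
Qed.

(** [u] is an arbitrary element because the feet of a segment are found by scanning the whole
    universe. *)
Lemma foot_of_seg b (u : U) (s : segment (side b)) :
  foot_of E (pos u) (pos (seg_elt b s)) <-> exists2 a, u = foot_elt b a & segm a = s.
Proof.
rewrite foot_of_pos; case: b s => s; case: u => u.
- rewrite (@pair_multipede_left _ _ _ _ [:: u; inl s]) //=; split.
    by case: u => // a /eqP e; exists a.
  by move=> [a [->] /eqP].
- rewrite (@pair_multipede_mixed _ _ _ _ (inl s) u) ?inE ?eqxx ?orbT //.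
  by split=> // -[].
- rewrite (@pair_multipede_mixed _ _ _ _ u (inl s)) ?inE ?eqxx ?orbT //.
  by split=> // -[].
- rewrite (@pair_multipede_right _ _ _ _ [:: u; inl s]) //=; split.
    by case: u => // a /eqP e; exists a.
  by move=> [a [->] /eqP].
Qed.

Lemma is_le_seg b (u : U) (s : segment (side b)) :
  is_le E (pos u) (pos (seg_elt b s)) <-> exists2 t, u = seg_elt b t & seg_le t s.
Proof.
rewrite is_le_pos; case: b s => s; case: u => u.
- rewrite (@pair_multipede_left _ _ _ _ [:: u; inl s]) //=; split.
    by case: u => // t e; exists t.
  by move=> [t [->]].
- rewrite (@pair_multipede_mixed _ _ _ _ (inl s) u) ?inE ?eqxx ?orbT //.
  by split=> // -[].
- rewrite (@pair_multipede_mixed _ _ _ _ u (inl s)) ?inE ?eqxx ?orbT //.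
  by split=> // -[].
- rewrite (@pair_multipede_right _ _ _ _ [:: u; inl s]) //=; split.
    by case: u => // t e; exists t.
  by move=> [t [->]].
Qed.

Lemma is_segment_seg b (u : U) :
  is_segment E (pos u) && (in_first E (pos u) == b) <-> exists s, u = seg_elt b s.
Proof.
rewrite is_segment_pos in_first_pos; case: u => u.
  rewrite (@pair_multipede_left _ _ _ _ [:: u]) //=.
  case: b => /=; rewrite ?andbT ?andbF; last by split=> // -[].
  by split=> [|[s [->]]] //; case: u => // s; exists s.
rewrite (@pair_multipede_right _ _ _ _ [:: u]) //=.
case: b => /=; rewrite ?andbT ?andbF; first by split=> // -[].
by split=> [|[s [->]]] //; case: u => // s; exists s.
Qed.

Lemma filter_pos (P : pred nat) :
  [seq i <- iota 0 E.2 | P i] = [seq pos u | u <- [seq u <- elements | P (pos u)]].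
Proof.
rewrite instance_size -index_iota; first by rewrite filter_map.
by rewrite sort_uniq enum_uniq.
Qed.

Lemma size_filter_pos (P : pred nat) :
  size [seq i <- iota 0 E.2 | P i] = #|[pred u : U | P (pos u)]|.
Proof.
rewrite filter_pos size_map size_filter (permP (permEl (perm_sort _ _))) -size_filter.
by rewrite cardE enumT /enum_mem; congr size; apply: eq_filter.
Qed.

Lemma mem_segments b i : i \in segments E b <-> exists s, i = pos (seg_elt b s).
Proof.
rewrite /segments filter_pos; split.
  move=> /mapP[u]; rewrite mem_filter => /andP[/is_segment_seg[s ->] _] ->.
  by exists s.
move=> [s ->]; apply: (map_f (fun u : U => pos u)); rewrite mem_filter mem_elements andbT.
by apply/is_segment_seg; exists s.
Qed.

Lemma size_segments b : size (segments E b) = #|segment (side b)|.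
Proof.
rewrite /segments size_filter_pos -(card_codom (@seg_elt_inj b)); apply: eq_card => u.
rewrite inE; apply/idP/codomP => [/is_segment_seg //|h]; exact/is_segment_seg.
Qed.

Lemma rank_seg b (s : segment (side b)) : rank E (pos (seg_elt b s)) = seg_rank s.
Proof.
rewrite /rank size_filter_pos /seg_rank -(card_imset _ (@seg_elt_inj b)).
apply: eq_card => u; rewrite inE; apply/idP/imsetP => [/is_le_seg[t -> le_ts]|[t]].
  by exists t; rewrite ?inE.
by rewrite inE => le_ts ->; apply/is_le_seg; exists t.
Qed.

(** By [two_feet] the scan finds exactly two entries, so [foot_at] never returns its default. *)
Lemma feet_named b (s : segment (side b)) : exists name : bool -> foot (side b),
  [/\ forall y, foot_at E (pos (seg_elt b s)) y = pos (foot_elt b (name y)),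
      forall y, segm (name y) = s, injective name
    & forall a, segm a = s -> exists y, a = name y].
Proof.
set L := [seq u <- elements | foot_of E (pos u) (pos (seg_elt b s))].
have feetE : feet E (pos (seg_elt b s)) = [seq pos u | u <- L] by apply: filter_pos.
have memL u : u \in L <-> exists2 a, u = foot_elt b a & segm a = s.
  by rewrite mem_filter mem_elements andbT; apply: foot_of_seg.
have uniqL : uniq L by rewrite filter_uniq // sort_uniq enum_uniq.
have sizeL : size L = 2.
  rewrite -(two_feet s) -(card_imset _ (@foot_elt_inj b)) -(card_uniqP uniqL).
  apply: eq_card => u; apply/idP/imsetP => [/memL[a -> e]|[a]].
    by exists a; rewrite // inE e.
  by rewrite inE => /eqP e ->; apply/memL; exists a.
case: L uniqL sizeL memL feetE => [|u0 [|u1 []]] //=.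
rewrite inE andbT => ne01 _ memL feetE.
have /memL[a0 e0 s0] : u0 \in [:: u0; u1] by rewrite inE eqxx.
have /memL[a1 e1 s1] : u1 \in [:: u0; u1] by rewrite !inE eqxx orbT.
have ne : a0 != a1 by apply: contra ne01 => /eqP e; rewrite e0 e1 e.
exists (fun y => if y then a1 else a0); split.
- by move=> y; rewrite /foot_at feetE e0 e1; case: y.
- by case.
- by move=> [] [] // e; rewrite e eqxx in ne.
- move=> a sa; have : foot_elt b a \in [:: u0; u1] by apply/memL; exists a.
  rewrite !inE e0 e1 !(inj_eq (@foot_elt_inj b)) => /orP[] /eqP ->.
    by exists false.
  by exists true.
Qed.

Lemma mem_matches m : m \in matches E <->
  exists s t, m = (pos (seg_elt true s), pos (seg_elt false t)) /\
    seg_rank s = seg_rank t.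
Proof.
rewrite /matches mem_filter; split.
  move=> /andP[/eqP er /allpairsP[[i j] [/= /mem_segments[s ei] /mem_segments[t ej] em]]].
  have e1 : m.1 = pos (seg_elt true s) by rewrite em ei.
  have e2 : m.2 = pos (seg_elt false t) by rewrite em ej.
  exists s, t; split; first by rewrite em ei ej.
  by move: er; rewrite e1 e2 !rank_seg.
move=> [s [t [-> er]]]; rewrite !rank_seg er eqxx /=.
apply/allpairsP; exists (pos (seg_elt true s), pos (seg_elt false t)).
by split=> //; apply/mem_segments; [exists s | exists t].
Qed.

Lemma profile_seg b (name : segment (side b) -> bool -> foot (side b)) s1 s2 s3 y :
  (forall s y, foot_at E (pos (seg_elt b s)) y = pos (foot_elt b (name s y))) ->
  profile E (pos (seg_elt b s1), (pos (seg_elt b s2), pos (seg_elt b s3))) y =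
  local_profile name (s1, (s2, s3)) y.
Proof.
move=> nameE.
by rewrite /profile /= !nameE is_positive_foot is_shoe_foot is_hyperedge_seg.
Qed.

(** As [isomorphicP] holds for any naming of the feet, it can be applied to the naming that
    [foot_at] induces; the two descriptions then agree triple by triple. *)
Lemma decide_encode : decide (encode le) <-> isomorphic M N.
Proof.
have naming b : exists name : segment (side b) -> bool -> foot (side b),
    foot_naming name /\
    forall s y, foot_at E (pos (seg_elt b s)) y = pos (foot_elt b (name s y)).
  have [name nameP] := fin_all_exists (@feet_named b).
  exists name; split; last by move=> s; have [] := nameP s.
  split=> [s|s|a]; first by have [] := nameP s.
    by have [] := nameP s.
  by have [_ _ _] := nameP (segm a); apply.
have [nameM [namingM nameME]] := naming true.
have [nameN [namingN nameNE]] := naming false.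
rewrite -[decide _]/(decide_instance E).
apply: (iff_trans (decide_instanceP E)).
apply: iff_sym; apply: (iff_trans (isomorphicP namingM namingN)).
rewrite !size_segments; split=> -[eq_card [x hx]]; split=> //.
(* A number is decoded to the segment of [M] at that position; all other unknowns get the dummy
   value [false]. *)
- exists (fun i => if [pick s | pos (seg_elt true s) == i] is Some s then x s else false).
  move=> m1 m2 m3 /mem_matches[s1 [t1 [-> r1]]] /mem_matches[s2 [t2 [-> r2]]].
  move=> /mem_matches[s3 [t3 [-> r3]]].
  have pickE s : (if [pick s' | pos (seg_elt true s') == pos (seg_elt true s)]
      is Some s' then x s' else false) = x s.
    case: pickP => [s' /eqP/pos_inj/seg_elt_inj -> //|/(_ s)].
    by rewrite eqxx.
  rewrite !pickE; apply/fittingP => y /=.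
  by rewrite (profile_seg _ _ _ _ nameME) (profile_seg _ _ _ _ nameNE); apply: hx.
- exists (fun s => x (pos (seg_elt true s))) => s1 s2 s3 t1 t2 t3 r1 r2 r3 y.
  rewrite -(profile_seg _ _ _ _ nameME) -(profile_seg _ _ _ _ nameNE).
  have matchE s t : seg_rank s = seg_rank t ->
      (pos (seg_elt true s), pos (seg_elt false t)) \in matches E.
    by move=> e; apply/mem_matches; exists s, t.
  by have /fittingP := hx _ _ _ (matchE _ _ r1) (matchE _ _ r2) (matchE _ _ r3); apply.
Qed.

End Pair.

Theorem mainTheorem7 :
  ptime_query multipede_pair
    (fun MN : shoed_multipede3 * shoed_multipede3 => isomorphic MN.1 MN.2).
Proof.
have [T polyT decT] := decide_machine.
exists T => // MN le _; apply: iff_trans (decT _) _; exact: decide_encode.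
Qed.
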